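(* Let $A=\mathbb{C}[a_{ij}\,:\,0\leq i\leq j,\ j>0]$ be the polynomial ring in the variables $a_{ij}$, and let $GW$ be the minimal Gromov–Witten ring defined in the context. Let $r\colon A\to GW$ be the $\mathbb{C}$-algebra homomorphism sending $a_{ij}$ to the class of the symbol $\langle H^1,H^j,H_i\rangle$. Then $r$ is an isomorphism.
   Context: Consider formal symbols $\langle \tau_{d_1}H^{i_1},\ldots,\tau_{d_{n-1}}H^{i_{n-1}},\tau_{d_n}H_r\rangle$ with $n\geq 1$ and $i_1,\ldots,i_{n-1},r,d_1,\ldots,d_n\in\mathbb{Z}_{\geq 0}$. The last entry carries a subscript, all the others carry superscripts. Write $H^i$ for $\tau_0H^i$ and $H_j$ for $\tau_0H_j$. The degree of such a symbol is $\sum_s d_s+\sum_{s=1}^{n-1} i_s-r+(3-n)$. Let $F$ be the set of all symbols of non-negative degree. The minimal Gromov–Witten ring is $GW=\mathbb{C}[F]/\mathrm{Rel}$, where $\mathbb{C}[F]$ is the polynomial ring whose variables are the elements of $F$. Convention: any symbol with a negative index or of negative degree that appears on a right-hand side below is interpreted as $0$. The ideal $\mathrm{Rel}$ is generated by the following relations. (GW1) Permuting the first $n-1$ entries $\tau_{d_s}H^{i_s}$ of a symbol does not change it. The last entry $\tau_{d_n}H_r$ stays in place. (GW2) Suppose $r=\sum d_s+\sum i_s+(3-n)$, i.e. the symbol has degree $0$. Then $\langle \tau_{d_1}H^{i_1},\ldots,\tau_{d_n}H_r\rangle=\frac{(d_1+\cdots+d_n)!}{d_1!\cdots d_n!}M$,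 where $M=1$ if $\sum d_j=n-3$ and $M=0$ otherwise. (GW3) $\langle H^0,\tau_{d_1}H^{i_1},\ldots,\tau_{d_{n-1}}H^{i_{n-1}},\tau_{d_n}H_r\rangle$ equals the sum of the following terms: - for each $j=1,\ldots,n-1$, the symbol obtained from $\langle\tau_{d_1}H^{i_1},\ldots,\tau_{d_{n-1}}H^{i_{n-1}},\tau_{d_n}H_r\rangle$ by replacing $d_j$ with $d_j-1$; - the term $\langle\tau_{d_1}H^{i_1},\ldots,\tau_{d_{n-1}}H^{i_{n-1}},\tau_{d_n-1}H_r\rangle$. The symbols $\langle H^0,H^i,H_i\rangle$ are excluded from (GW3); they are given by (GW2). (GW4) Let $d>0$ be the degree of the left-hand side. Then $\langle H^1,\tau_{d_1}H^{i_1},\ldots,\tau_{d_{n-1}}H^{i_{n-1}},\tau_{d_n}H_r\rangle = d\,\langle\tau_{d_1}H^{i_1},\ldots,\tau_{d_n}H_r\rangle+\sum_{s=1}^{n-1}\langle\tau_{d_1}H^{i_1},\ldots,\tau_{d_s-1}H^{i_s+1},\ldots,\tau_{d_n}H_r\rangle+\langle\tau_{d_1}H^{i_1},\ldots,\tau_{d_n-1}H_{r-1}\rangle$. (GW5) Fix $n\geq 0$ and numbers $c_1,\ldots,c_n,i_1,\ldots,i_n$. For $S\subset\{1,\ldots,n\}$ let $\coprod_S$ denote the sequence of entries $\tau_{c_s}H^{i_s}$, $s\in S$. Then two relations hold. - If $d_1\geq 1$: $\langle\coprod_{\{1,\ldots,n\}},\tau_{d_1}H^{j_1},\tau_{d_2}H^{j_2},\tau_{d_3}H_r\rangle=\sum\langle\tau_{d_1-1}H^{j_1},\coprod_{S_1},H_a\rangle\langle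 H^a,\coprod_{S_2},\tau_{d_2}H^{j_2},\tau_{d_3}H_r\rangle$. - If $d_3\geq 1$: $\langle\coprod_{\{1,\ldots,n\}},\tau_{d_1}H^{j_1},\tau_{d_2}H^{j_2},\tau_{d_3}H_r\rangle=\sum\langle\coprod_{S_1},\tau_{d_1}H^{j_1},\tau_{d_2}H^{j_2},H_a\rangle\langle H^a,\coprod_{S_2},\tau_{d_3-1}H_r\rangle$. In both relations the sum runs over all splittings $S_1\sqcup S_2=\{1,\ldots,n\}$ and all $a\in\mathbb{Z}_{\geq 0}$ for which every symbol involved has non-negative degree. Such sums are finite. *)

(* Defs.v *)
From HB Require Import structures.
From mathcomp Require Import all_boot all_algebra.
From mathcomp Require Import Rstruct complex.
From mathcomp Require Import finmap.
From mathcomp.multinomials Require Import monalg.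

Set Implicit Arguments.
Unset Strict Implicit.
Unset Printing Implicit Defensive.

Import GRing.Theory Num.Theory.
Local Open Scope ring_scope.

Definition C : fieldType := complex Rdefinitions.R.

(* A formal symbol <tau_{d_1}H^{i_1},...,tau_{d_{n-1}}H^{i_{n-1}},tau_{d_n}H_r>
   is encoded as (l, (d_n, r)) where l = [:: (d_1,i_1); ...; (d_{n-1},i_{n-1})].
   Thus n = size l + 1 >= 1 automatically. *)
Definition sym := (seq (nat * nat) * (nat * nat))%type.

Definition nentries (s : sym) : nat := (size s.1).+1.

Definition deg (s : sym) : int :=
  (sumn [seq p.1 | p <- s.1] + s.2.1 + sumn [seq p.2 | p <- s.1])%:Z
  - (s.2.2)%:Z + 3%:Z - (nentries s)%:Z.

Definition Fsym := {s : sym | 0 <= deg s}.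

Definition CF := {malg C[cmonom Fsym]}.

Definition varF (f : Fsym) : CF := mkmalgU (ucm f) (1 : C).

Definition sv (s : sym) : CF :=
  match insub s with Some f => varF f | None => 0 end.

Definition ent (l : seq (nat * nat)) (j : nat) : nat * nat := nth (0%N, 0%N) l j.

Definition dlist (s : sym) : seq nat := [seq p.1 | p <- s.1] ++ [:: s.2.1].

Definition gw2_value (s : sym) : C :=
  if ((sumn (dlist s))%:Z == (nentries s)%:Z - 3%:Z)
  then ((sumn (dlist s))`!)%:R / (\prod_(d <- dlist s) d`!)%:R
  else 0.

Definition gw3_rhs (l : seq (nat * nat)) (dn r : nat) : CF :=
  \sum_(j < size l)
     (if (0 < (ent l j).1)%N
      then sv (set_nth (0%N, 0%N) l j (((ent l j).1).-1, (ent l j).2), (dn, r))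
      else 0)
  + (if (0 < dn)%N then sv (l, (dn.-1, r)) else 0).

Definition gw4_rhs (d : int) (l : seq (nat * nat)) (dn r : nat) : CF :=
  d%:~R * sv (l, (dn, r))
  + \sum_(j < size l)
     (if (0 < (ent l j).1)%N
      then sv (set_nth (0%N, 0%N) l j (((ent l j).1).-1, ((ent l j).2).+1), (dn, r))
      else 0)
  + (if (0 < dn)%N && (0 < r)%N then sv (l, (dn.-1, r.-1)) else 0).

Definition subl (ll : seq (nat * nat)) (S : {set 'I_(size ll)}) : seq (nat * nat) :=
  [seq ent ll (val i) | i <- enum S].

(* a bound beyond which every summand of GW5 vanishes (negative degree) *)
Definition gw5_bound (ll : seq (nat * nat)) (d1 j1 d2 j2 : nat) : nat :=
  (sumn [seq p.1 + p.2 | p <- ll] + d1 + j1 + d2 + j2 + 3)%N.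

Definition gw5_rhs1 (ll : seq (nat * nat)) (d1 j1 d2 j2 d3 r : nat) : CF :=
  \sum_(S : {set 'I_(size ll)})
   \sum_(a <- iota 0 (gw5_bound ll d1 j1 d2 j2).+1)
     sv ((d1.-1, j1) :: subl S, (0%N, a))
     * sv ((0%N, a) :: subl (~: S) ++ [:: (d2, j2)], (d3, r)).

Definition gw5_rhs2 (ll : seq (nat * nat)) (d1 j1 d2 j2 d3 r : nat) : CF :=
  \sum_(S : {set 'I_(size ll)})
   \sum_(a <- iota 0 (gw5_bound ll d1 j1 d2 j2).+1)
     sv (subl S ++ [:: (d1, j1); (d2, j2)], (0%N, a))
     * sv ((0%N, a) :: subl (~: S), (d3.-1, r)).

Inductive gen : CF -> Prop :=
  | gen1 (l l' : seq (nat * nat)) (last : nat * nat) :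
      0 <= deg (l, last) -> perm_eq l l' ->
      gen (sv (l, last) - sv (l', last))
  | gen2 (s : sym) : deg s = 0 -> gen (sv s - (gw2_value s)%:MP)
  | gen3 (l : seq (nat * nat)) (dn r : nat) :
      0 <= deg ((0%N, 0%N) :: l, (dn, r)) ->
      ~ (exists i, l = [:: (0%N, i)] /\ (dn, r) = (0%N, i)) ->
      gen (sv ((0%N, 0%N) :: l, (dn, r)) - gw3_rhs l dn r)
  | gen4 (l : seq (nat * nat)) (dn r : nat) :
      0 < deg ((0%N, 1%N) :: l, (dn, r)) ->
      gen (sv ((0%N, 1%N) :: l, (dn, r))
           - gw4_rhs (deg ((0%N, 1%N) :: l, (dn, r))) l dn r)
  | gen5a (ll : seq (nat * nat)) (d1 j1 d2 j2 d3 r : nat) :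
      0 <= deg (ll ++ [:: (d1, j1); (d2, j2)], (d3, r)) -> (1 <= d1)%N ->
      gen (sv (ll ++ [:: (d1, j1); (d2, j2)], (d3, r)) - gw5_rhs1 ll d1 j1 d2 j2 d3 r)
  | gen5b (ll : seq (nat * nat)) (d1 j1 d2 j2 d3 r : nat) :
      0 <= deg (ll ++ [:: (d1, j1); (d2, j2)], (d3, r)) -> (1 <= d3)%N ->
      gen (sv (ll ++ [:: (d1, j1); (d2, j2)], (d3, r)) - gw5_rhs2 ll d1 j1 d2 j2 d3 r).

Definition Rel (p : CF) : Prop :=
  exists (k : nat) (c g : 'I_k -> CF),
    (forall j, gen (g j)) /\ p = \sum_(j < k) c j * g j.

Definition Avar := {p : nat * nat | (p.1 <= p.2)%N && (0 < p.2)%N}.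

Definition Aring := {malg C[cmonom Avar]}.

Definition a_sym (v : Avar) : sym :=
  ([:: (0%N, 1%N); (0%N, (val v).2)], (0%N, (val v).1)).

(* the C-algebra homomorphism A -> C[F], a_ij |-> <H^1,H^j,H_i>;
   r : A -> GW = C[F]/Rel is its composite with the quotient map. *)
Definition rho (p : Aring) : CF :=
  \sum_(m <- msupp p)
     (p@_m)%:MP * \prod_(v <- finsupp (cmonom_val m)) sv (a_sym v) ^+ (cmonom_val m v).

(* Main.v *)
(* Injectivity requires a ring morphism GW -> A inverse to r, that is, a solution
   of (GW1)-(GW5) in A with <H^1, H^j, H_i> = a_ij.  It comes from Givental's
   description of a genus zero theory by an overruled cone.  The series u_j with
   leading term H^j that satisfy
     (q d/dq + H) u_j = u_(j+1) + sum_(i <= j) a_ij q^(j+1-i) u_i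
   are found degree by degree in q, and v = u_0 is the J-function.  Let sig be the
   A[q]-linear map A[h, q] -> A[[H, q]] sending 1 to v and turning h + q d/dq into
   H + q d/dq.  The points z exp(p / z), with p polynomial in z, form a cone whose
   tangent space at such a point is exp(p / z) A[h, q, z].  Use as coordinates on
   the cone the nonnegative powers of z in the image under sig; the negative
   powers of z are then the generating functions of the invariants.  A tangent
   vector is determined by its nonnegative part, so the string, divisor and
   topological recursion relations are equalities of tangent vectors with equal
   nonnegative parts.  In degree zero the invariants do not depend on how the
   cohomology classes are distributed over the entries, and the string equation
   turns them into multinomial coefficients.

   Surjectivity is reconstruction by induction on the degree.  The divisor
   equation and topological recursion reduce the one- and two-point symbols to
   the <H^1, H^j, H_i>; with more points, topological recursion removes the psi
   classes, and the WDVV equation, itself a consequence of topological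
   recursion, trades H^i for H^1 and H^(i-1).                                   *)
Require Import Defs.
From HB Require Import structures.
From mathcomp Require Import all_boot all_algebra.
From mathcomp Require Import Rstruct complex finmap.
From mathcomp.multinomials Require Import monalg.
From mathcomp Require Import zify ring.

Set Implicit Arguments.
Unset Strict Implicit.
Unset Printing Implicit Defensive.

Import GRing.Theory Num.Theory.
Local Open Scope ring_scope.

(** * Taylor coefficients indexed by lists of directions *)

Section Convolution.
Variable R : comNzRingType.
Local Notation T := (nat * nat)%type.
Implicit Types (f g h : seq T -> R) (l : seq T) (b : T).

(* A function of lists stands for the Taylor coefficients of a function, and
   fun s => f (b :: s) for its derivative in the direction b: conv is the product,
   defined by the Leibniz rule. *)
Fixpoint conv f g l : R :=
  if l is b :: l' then
    conv (fun s => f (b :: s)) g l' + conv f (fun s => g (b :: s)) l'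
  else f [::] * g [::].

(** Unfolding the Leibniz rule writes [conv f g l] as the sum of [f s * g t] over all splittings of
    [l] into two sublists, so a property stable under addition can be tested on these products. *)
Lemma conv_ind (P : R -> Prop) :
  (forall x y, P x -> P y -> P (x + y)) ->
  forall l f g, (forall s t : seq T, perm_eq (s ++ t) l -> P (f s * g t)) ->
  P (conv f g l).
Proof.
move=> PD; elim=> [|b l IHl] f g fgP /=; first exact: (fgP [::] [::]).
apply: PD; apply: IHl => s t st; apply: fgP; first by rewrite /= perm_cons.
by rewrite -cat1s perm_catCA /= perm_cons.
Qed.

Lemma eq_conv_perm l f g f' g' :
  (forall s t : seq T, perm_eq (s ++ t) l -> f s * g t = f' s * g' t) ->
  conv f g l = conv f' g' l.
Proof.
elim: l f g f' g' => [|b l IHl] f g f' g' fgP /=; first exact: (fgP [::] [::]).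
congr (_ + _); apply: IHl => s t st; apply: fgP; first by rewrite /= perm_cons.
by rewrite -cat1s perm_catCA /= perm_cons.
Qed.

Lemma eq_conv l f g f' g' :
  (forall s, (size s <= size l)%N -> f s = f' s) ->
  (forall s, (size s <= size l)%N -> g s = g' s) ->
  conv f g l = conv f' g' l.
Proof.
move=> ff' gg'; apply: eq_conv_perm => s t /perm_size; rewrite size_cat => st.
by rewrite ff' ?gg' // -st ?leq_addl ?leq_addr.
Qed.

Lemma convC f g l : conv f g l = conv g f l.
Proof.
by elim: l f g => [|b l IHl] f g /=; [rewrite mulrC | rewrite addrC !(IHl _ g, IHl f)].
Qed.

Lemma convDl f f' g l : conv (fun s => f s + f' s) g l = conv f g l + conv f' g l.
Proof.
elim: l f f' g => [|b l IHl] f f' g /=; first by rewrite mulrDl.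
by rewrite !IHl addrACA.
Qed.

Lemma convDr f g g' l : conv f (fun s => g s + g' s) l = conv f g l + conv f g' l.
Proof. by rewrite convC convDl !(convC f). Qed.

Lemma convNl f g l : conv (fun s => - f s) g l = - conv f g l.
Proof.
by elim: l f g => [|b l IHl] f g /=; rewrite ?mulNr // !IHl opprD.
Qed.

Lemma convBl f f' g l : conv (fun s => f s - f' s) g l = conv f g l - conv f' g l.
Proof. by rewrite convDl convNl. Qed.

Lemma convBr f g g' l : conv f (fun s => g s - g' s) l = conv f g l - conv f g' l.
Proof. by rewrite convC convBl !(convC f). Qed.

Lemma conv0l g l : conv (fun=> 0) g l = 0.
Proof. by elim: l g => [|b l IHl] g /=; rewrite ?mul0r // !IHl addr0. Qed.

Lemma conv_suml (I : Type) (r : seq I) (f : I -> seq T -> R) g l :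
  conv (fun s => \sum_(i <- r) f i s) g l = \sum_(i <- r) conv (f i) g l.
Proof.
elim: r => [|i r IHr].
  rewrite big_nil -[RHS](conv0l g l); apply: eq_conv => // s _.
  by rewrite big_nil.
rewrite big_cons -IHr -convDl; apply: eq_conv => // s _.
by rewrite big_cons.
Qed.

Lemma convA f g h l : conv f (conv g h) l = conv (conv f g) h l.
Proof.
elim: l f g h => [|b l IHl] f g h /=; first by rewrite mulrA.
by rewrite convDr convDl !IHl addrA.
Qed.

Lemma convCA f g h l : conv f (conv g h) l = conv g (conv f h) l.
Proof.
rewrite !convA; apply: eq_conv => // s _; exact: convC.
Qed.

Definition delta1 (x : R) l : R := if l is [::] then x else 0.

Lemma conv_delta1 x g l : conv (delta1 x) g l = x * g l.
Proof.
elim: l g => [|b l IHl] g //=.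
by rewrite IHl conv0l add0r.
Qed.

(** In [conv f (tail_part g) l] only the values of [f] on lists shorter than [l] matter, which makes
    recursion on the length possible. *)
Definition tail_part g l : R := if l is [::] then 0 else g l.

Lemma conv_tail f g l : conv f g l = f l * g [::] + conv f (tail_part g) l.
Proof.
rewrite mulrC -conv_delta1 convC -(convC (tail_part g)) -convDl.
by apply: eq_conv => // -[|b s] _; rewrite /= ?addr0 ?add0r.
Qed.

Lemma eq_conv_tail l f g f' g' :
  (forall s, (size s < size l)%N -> f s = f' s) ->
  (forall s, (size s <= size l)%N -> g s = g' s) ->
  conv f (tail_part g) l = conv f' (tail_part g') l.
Proof.
move=> ff' gg'; apply: eq_conv_perm => s t /perm_size; rewrite size_cat => st.
case: t st => [|c t] /= st; first by rewrite !mulr0.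
by rewrite ff' ?gg' -?st //=; lia.
Qed.

(** Symmetry restricted to lists of length at most [n], the form available in an induction on the
    length. *)
Definition symfun n f := forall l l' : seq T, (size l <= n)%N -> perm_eq l l' -> f l = f l'.

Lemma symfunW m n f : (m <= n)%N -> symfun n f -> symfun m f.
Proof. by move=> mn fS l l' lm; apply: fS; apply: leq_trans mn. Qed.

Lemma conv_sym n f g : symfun n f -> symfun n g -> symfun n (conv f g).
Proof.
have symD m h b : symfun m.+1 h -> symfun m (fun s => h (b :: s)).
  by move=> hS l l' lm ll'; apply: hS; rewrite ?perm_cons.
(* Exchanging two neighbouring directions only permutes the terms of the Leibniz rule, so [b] moves
   to the front one place at a time. *)
have insert m f' g' u b v : symfun m f' -> symfun m g' -> (size (u ++ b :: v) <= m)%N ->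
    conv f' g' (u ++ b :: v) = conv f' g' (b :: u ++ v).
  elim: u m f' g' => [//|a u IHu] [//|m] f' g' f'S g'S um.
  have swap h : symfun m.+1 h -> forall s, (size s <= size (u ++ v))%N ->
      h [:: a, b & s] = h [:: b, a & s].
    move=> hS s ss; apply: hS; first by move: ss um; rewrite /= !size_cat /=; lia.
    by rewrite (perm_catCA [:: a] [:: b] s).
  rewrite cat_cons /= !(IHu m) //; try exact: (symfunW (leqnSn m)); try exact: symD.
  rewrite /= addrACA; congr (_ + _); congr (_ + _); apply: eq_conv => // s ss;
    by rewrite swap.
elim: n f g => [|n IHn] f g fS gS l l'.
  by case: l => [|//] _; rewrite perm_sym => /perm_nilP->.
case: l => [_|b l]; first by rewrite perm_sym => /perm_nilP->.
rewrite /= ltnS => ln ll'.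
have bl' : b \in l' by rewrite -(perm_mem ll') mem_head.
case/splitPr: bl' ll' => u v ll'.
have luv : perm_eq l (u ++ v).
  by rewrite -(perm_cons b) (perm_trans ll') // -cat1s perm_catCA.
rewrite (insert n.+1) //; last by rewrite -(perm_size ll').
by congr (_ + _); apply: IHn => //;
  [exact: symD | exact: (symfunW (leqnSn n)) | exact: (symfunW (leqnSn n)) | exact: symD].
Qed.

End Convolution.

Lemma conv_morph (R R' : comNzRingType) (phi : R -> R') (f g : seq (nat * nat) -> R)
    (f' g' : seq (nat * nat) -> R') l :
  {morph phi : x y / x + y} ->
  (forall s t : seq (nat * nat), perm_eq (s ++ t) l -> phi (f s * g t) = f' s * g' t) ->
  phi (conv f g l) = conv f' g' l.
Proof.
move=> phiD; elim: l f g f' g' => [|b l IHl] f g f' g' fgP /=.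
  exact: (fgP [::] [::]).
rewrite phiD; congr (_ + _); apply: IHl => s t st; apply: fgP.
  by rewrite /= perm_cons.
by rewrite -cat1s perm_catCA /= perm_cons.
Qed.

(** * Weights of lists, and sums over lowered entries *)

Section Entries.
Local Notation lab := (nat * nat)%type.
Implicit Types (b : lab) (l s t : seq lab).

Definition sumw l := sumn [seq (b.1 + b.2)%N | b <- l].

Lemma sumw_cons b l : sumw (b :: l) = (b.1 + b.2 + sumw l)%N.
Proof. by []. Qed.

Lemma sumw_cat s t : sumw (s ++ t) = (sumw s + sumw t)%N.
Proof. by rewrite /sumw map_cat sumn_cat. Qed.

Lemma sumw_perm s t : perm_eq s t -> sumw s = sumw t.
Proof. by move=> st; apply/perm_sumn/perm_map. Qed.

Lemma size_perm l l' : perm_eq l l' -> size l = size l'.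
Proof. exact: perm_size. Qed.

Lemma split_size s t l : perm_eq (s ++ t) l -> size l = (size s + size t)%N.
Proof. by move/perm_size <-; rewrite size_cat. Qed.

Lemma split_sumw s t l : perm_eq (s ++ t) l -> sumw l = (sumw s + sumw t)%N.
Proof. by move/sumw_perm <-; rewrite sumw_cat. Qed.

End Entries.

Section Lowering.
Local Notation lab := (nat * nat)%type.
Variable k : nat.

(** A psi class is traded for H^k: [k = 0] gives the terms of the string equation, [k = 1] those of
    the divisor equation. *)
Definition lower_lab (b : lab) : lab := (b.1.-1, (b.2 + k)%N).

(** The lowered entry is passed separately from the others, so that [F] can be a family of functions
    indexed by a direction; [low_at] keeps it in its place, as the relations do. *)
Fixpoint low (V : nmodType) (F : lab -> seq lab -> V) l : V :=
  if l is b :: l' then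
    (if (0 < b.1)%N then F (lower_lab b) l' else 0) + low (fun a s => F a (b :: s)) l'
  else 0.

Fixpoint low_at (V : nmodType) (f : seq lab -> V) l : V :=
  if l is b :: l' then
    (if (0 < b.1)%N then f (lower_lab b :: l') else 0) + low_at (fun s => f (b :: s)) l'
  else 0.

Lemma low_ind (V : nmodType) (Q : V -> Prop) l (F : lab -> seq lab -> V) :
  Q 0 -> (forall x y, Q x -> Q y -> Q (x + y)) ->
  (forall (b : lab) (s : seq lab), perm_eq (b :: s) l -> (0 < b.1)%N -> Q (F (lower_lab b) s)) ->
  Q (low F l).
Proof.
move=> Q0 QD; elim: l F => [|b l IHl] F QF //=; apply: QD.
  by case: ifP => // b0; apply: QF.
apply: IHl => a s asl a0; apply: QF => //.
by rewrite -cat1s (perm_catCA [:: a] [:: b]) /= perm_cons.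
Qed.

Lemma low_morph (V W : nmodType) (phi : V -> W) (F : lab -> seq lab -> V)
    (G : lab -> seq lab -> W) l :
  phi 0 = 0 -> {morph phi : x y / x + y} ->
  (forall (b : lab) (s : seq lab), perm_eq (b :: s) l -> (0 < b.1)%N ->
     phi (F (lower_lab b) s) = G (lower_lab b) s) ->
  phi (low F l) = low G l.
Proof.
move=> phi0 phiD; elim: l F G => [|b l IHl] F G FG //=; rewrite phiD.
congr (_ + _); first by case: ifP => // b0; rewrite FG.
apply: IHl => a s asl a0; apply: FG => //.
by rewrite -cat1s (perm_catCA [:: a] [:: b]) /= perm_cons.
Qed.

Lemma eq_low (V : nmodType) (F G : lab -> seq lab -> V) l :
  (forall a s, F a s = G a s) -> low F l = low G l.
Proof. by move=> FG; apply: (low_morph (phi := id)). Qed.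

Lemma lowD (V : nmodType) (F G : lab -> seq lab -> V) l :
  low (fun a s => F a s + G a s) l = low F l + low G l.
Proof.
elim: l F G => [|b l IHl] F G /=; first by rewrite addr0.
by rewrite IHl addrACA; congr (_ + _); case: ifP; rewrite ?addr0.
Qed.

(** With x_b the coordinate in direction b, [low F] lists the Taylor coefficients of the sum of x_b
    F(b lowered), and multiplication by [g] commutes with the factors x_b. *)
Lemma conv_low (R : comNzRingType) (F : lab -> seq lab -> R) g l :
  conv (low F) g l = low (fun a => conv (F a) g) l.
Proof.
elim: l F g => [|b l IHl] F g /=; first by rewrite mul0r.
rewrite convDl !IHl lowD -addrA; congr (_ + _).
by case: ifP => // _; exact: conv0l.
Qed.

Lemma low_lowat (V : nmodType) (f : seq lab -> V) l :
  (forall s t : seq lab, perm_eq s t -> f s = f t) ->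
  low (fun a s => f (a :: s)) l = low_at f l.
Proof.
elim: l f => [|b l IHl] f fS //=; congr (_ + _); rewrite -IHl.
  by apply: eq_low => a s; apply: fS; rewrite (perm_catCA [:: a] [:: b]).
by move=> s t st; apply: fS; rewrite perm_cons.
Qed.

Lemma low_at_sum (V : nmodType) (f : seq lab -> V) l :
  low_at f l = \sum_(j < size l)
    (if (0 < (nth (0%N, 0%N) l j).1)%N
     then f (set_nth (0%N, 0%N) l j (lower_lab (nth (0%N, 0%N) l j))) else 0).
Proof.
elim: l f => [|b l IHl] f /=; first by rewrite big_ord0.
by rewrite big_ord_recl; congr (_ + _); rewrite IHl.
Qed.

Lemma low_at_morph (V W : nmodType) (phi : V -> W) (f : seq lab -> V) (g : seq lab -> W) l :
  phi 0 = 0 -> {morph phi : x y / x + y} ->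
  (forall s : seq lab, size s = size l -> (sumw s + 1 = sumw l + k)%N -> phi (f s) = g s) ->
  phi (low_at f l) = low_at g l.
Proof.
move=> phi0 phiD; elim: l f g => [|b l IHl] f g fg //=; rewrite phiD.
congr (_ + _); last first.
  by apply: IHl => s sl swl; apply: fg; rewrite ?sumw_cons /= ?sl //; lia.
by case: ifP => // b0; apply: fg; rewrite ?sumw_cons /lower_lab //=; lia.
Qed.

End Lowering.

(** * The fundamental solution *)

Section FundamentalSolution.
Variable K : comNzRingType.
Local Notation P := {poly {poly K}}.
Implicit Types (f : {poly K}) (p : P).

(** Coefficient of H^r in the product of f(H) with the series in H whose coefficients are [x]. *)
Definition act f (x : nat -> K) (r : nat) : K := \sum_(m < r.+1) f`_m * x (r - m)%N.

Lemma actD f g (x : nat -> K) r : act (f + g) x r = act f x r + act g x r.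
Proof.
by rewrite /act -big_split; apply: eq_bigr => m _; rewrite coefD mulrDl.
Qed.

Lemma actZ c f (x : nat -> K) r : act (c *: f) x r = c * act f x r.
Proof. by rewrite /act mulr_sumr; apply: eq_bigr => m _; rewrite coefZ mulrA. Qed.

Lemma act0 (x : nat -> K) r : act 0 x r = 0.
Proof. by rewrite -(scale0r 0) actZ mul0r. Qed.

Lemma actXM f (x : nat -> K) r : act ('X * f) x r = if r is r'.+1 then act f x r' else 0.
Proof.
rewrite /act big_ord_recl coefXM eqxx mul0r add0r.
case: r => [|r]; first by rewrite big_ord0.
by apply: eq_bigr => m _; rewrite coefXM.
Qed.

Variable v : nat -> nat -> K.

(* The K[q]-linear map from polynomials in h, q to series in H, q which sends 1
   to v and intertwines h + q d/dq with H + q d/dq: on the coefficient of q^d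
   in v the variable h acts as H + d. *)
Definition sig p r d : K :=
  \sum_(e < d.+1) act (p`_e \Po ('X + (d - e)%:R%:P)) (v^~ (d - e)%N) r.

Lemma sigD p p' r d : sig (p + p') r d = sig p r d + sig p' r d.
Proof.
by rewrite /sig -big_split; apply: eq_bigr => e _; rewrite coefD comp_polyD actD.
Qed.

Lemma sigqM c k p r d :
  sig (c%:P *: 'X^k * p) r d = if (k <= d)%N then c * sig p r (d - k) else 0.
Proof.
have coefE e : (c%:P *: 'X^k * p)`_e = if (e < k)%N then 0 else c *: p`_(e - k).
  by rewrite -scalerAl coefZ coefXnM; case: ifP => // _; rewrite ?mulr0 ?mul_polyC.
rewrite /sig; case: leqP => kd; last first.
  apply: big1 => e _; rewrite coefE ifT ?comp_poly0 ?act0 //.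
  by apply: leq_trans kd; exact: ltn_ord.
rewrite (big_ord_widen_cond d.+1 xpredT
  (fun e => act (p`_e \Po ('X + (d - k - e)%:R%:P)) (v^~ (d - k - e)%N) r));
  last by rewrite ltnS leq_subr.
rewrite -(big_mkord xpredT
  (fun e => act ((c%:P *: 'X^k * p)`_e \Po ('X + (d - e)%:R%:P)) (v^~ (d - e)%N) r)).
rewrite (@big_cat_nat _ _ _ k) //=; last exact: leqW.
rewrite [X in X + _]big_nat [X in X + _]big1 ?add0r; last first.
  by move=> e /andP[_ ek]; rewrite coefE ek comp_poly0 act0.
rewrite -{1}[k]add0n big_addn big_mkord mulr_sumr.
rewrite -(big_ord_widen d.+1 
  (fun e => c * act (p`_e \Po ('X + (d - k - e)%:R%:P)) (v^~ (d - k - e)%N) r));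
  last by rewrite ltnS leq_subr.
rewrite subSn //; apply: eq_bigr => e _.
rewrite coefE ltnNge leq_addl /= addnK comp_polyZ actZ.
by rewrite [(e + k)%N]addnC subnDA.
Qed.

Definition theta p : P := 'X * p^`().

Lemma coef_theta p e : (theta p)`_e = p`_e *+ e.
Proof. by rewrite /theta coefXM; case: e => [|e] //=; rewrite coef_deriv. Qed.

Lemma thetaD p p' : theta (p + p') = theta p + theta p'.
Proof. by rewrite /theta derivD mulrDr. Qed.

Lemma thetaM p p' : theta (p * p') = theta p * p' + p * theta p'.
Proof. by rewrite /theta derivM; ring. Qed.

(** On the coefficient of q^e in [p], paired with that of q^(d-e) in [v], the variable h acts as H +
    d - e and q d/dq as e; the sum is H + d. *)
Lemma sig_intertwine p r d :
  sig ('X%:P * p + theta p) r d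
  = d%:R * sig p r d + (if r is r'.+1 then sig p r' d else 0).
Proof.
have -> : (if r is r'.+1 then sig p r' d else 0) =
    \sum_(e < d.+1) act ('X * (p`_e \Po ('X + (d - e)%:R%:P))) (v^~ (d - e)%N) r.
  case: r => [|r]; last by apply: eq_bigr => e _; rewrite actXM.
  by rewrite big1 // => e _; rewrite actXM.
rewrite mulr_sumr -big_split; apply: eq_bigr => e _ /=.
rewrite coefD coef_theta mul_polyC coefZ comp_polyD comp_polyM comp_polyX.
have -> : p`_e *+ e \Po ('X + (d - e)%:R%:P) = e%:R *: (p`_e \Po ('X + (d - e)%:R%:P)).
  by rewrite -scaler_nat comp_polyZ.
have -> : d%:R = (d - e)%:R + e%:R :> K by rewrite -natrD subnK // -ltnS ltn_ord.
rewrite mulrDl mul_polyC !actD !actZ; ring.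
Qed.

Lemma sig1 r d : sig 1 r d = v r d.
Proof.
rewrite /sig big_ord_recl coef1 eqxx subn0 big1 => [|e _]; last first.
  by rewrite coef1 /= comp_poly0 act0.
rewrite addr0 comp_polyC /act big_ord_recl big1 => [|m _]; last first.
  by rewrite coefC /= mul0r.
by rewrite coefC eqxx mul1r addr0 subn0.
Qed.

Hypothesis v_q0 : forall r, v r 0%N = (r == 0%N)%:R.

(** Since [v] is 1 at q = 0, the lowest power of q keeps its coefficient, with h replaced by H. So
    [sig] is unitriangular in the powers of q. *)
Lemma sig_lead p r d : (forall e, (e < d)%N -> p`_e = 0) -> sig p r d = p`_d`_r.
Proof.
move=> p0; rewrite /sig big_ord_recr /= big1 ?add0r; last first.
  by move=> e _; rewrite p0 ?comp_poly0 ?act0.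
rewrite subnn addr0 comp_polyXr /act big_ord_recr /= big1 ?add0r.
  by rewrite subnn v_q0 mulr1.
by move=> m _; rewrite v_q0 subn_eq0 leqNgt ltn_ord mulr0.
Qed.

Lemma sig0 r d : sig 0 r d = 0.
Proof. by rewrite sig_lead ?coef0 // => e; rewrite !coef0. Qed.

Lemma sigN p r d : sig (- p) r d = - sig p r d.
Proof. by apply/eqP; rewrite -addr_eq0 -sigD addNr sig0. Qed.

Lemma sigB p p' r d : sig (p - p') r d = sig p r d - sig p' r d.
Proof. by rewrite sigD sigN. Qed.

Lemma sig_sum (I : Type) (s : seq I) (F : I -> P) r d :
  sig (\sum_(i <- s) F i) r d = \sum_(i <- s) sig (F i) r d.
Proof.
elim/big_rec2: _ => [|i y1 y2 _ <-]; [exact: sig0 | exact: sigD].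
Qed.

Definition deglt n p := forall r d, (n <= r + d)%N -> p`_d`_r = 0.

Lemma deglt0 p : deglt 0 p -> p = 0.
Proof. by move=> p0; apply/polyP => d; apply/polyP => r; rewrite p0 ?coef0. Qed.

Lemma degltM m n p p' : deglt m p -> deglt n p' -> deglt (m + n).-1 (p * p').
Proof.
move=> pm pn r d rd; rewrite coefM coef_sum big1 // => i _.
rewrite coefM big1 // => j _; have [ji|ji] := leqP m (j + i).
  by rewrite pm ?mul0r.
by rewrite pn ?mulr0 //; have := ltn_ord i; have := ltn_ord j; lia.
Qed.

Lemma sig_inj n p :
  deglt n p -> (forall r d, (r + d < n)%N -> sig p r d = 0) -> p = 0.
Proof.
move=> pn p0; apply/polyP => d; rewrite coef0.
have [m] := ubnP d; elim: m d => // m IHm d; rewrite ltnS => dm.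
apply/polyP => r; rewrite coef0; have [rd|] := ltnP (r + d) n; last exact: pn.
rewrite -sig_lead ?p0 // => e ed; apply: IHm; exact: leq_trans dm.
Qed.

(** Triangular solution by powers of q: step [m'] corrects the coefficient of q^m' and, by
    [sig_lead], leaves the lower ones unchanged. The range [r < n - m'] keeps the total degree below
    [n]. *)
Fixpoint solve_upto (x : nat -> nat -> K) n m : P :=
  if m is m'.+1 then
    let p := solve_upto x n m' in
    p + (\poly_(r < n - m') (x r m' - sig p r m')) *: 'X^m'
  else 0.

Definition solve (x : nat -> nat -> K) n := solve_upto x n n.

Lemma eq_solve (x y : nat -> nat -> K) n :
  (forall r d, x r d = y r d) -> solve x n = solve y n.
Proof.
move=> xy; rewrite /solve; elim: {2 4}n => //= m ->; congr (_ + _ *: _).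
by apply/polyP => r; rewrite !coef_poly xy.
Qed.

Lemma deglt_solve (x : nat -> nat -> K) n : deglt n (solve x n).
Proof.
rewrite /solve; elim: {3}n => [|m IHm] r d rd /=; first by rewrite !coef0.
rewrite coefD coefD IHm // add0r coefZ coefXn.
have [dm|] := eqVneq d m; last by rewrite mulr0 coef0.
by rewrite mulr1 coef_poly -dm ltn_subRL ltnNge addnC rd.
Qed.

Lemma sig_solve (x : nat -> nat -> K) n r d : (r + d < n)%N -> sig (solve x n) r d = x r d.
Proof.
rewrite /solve => rdn; have : (d < n)%N by apply: leq_ltn_trans rdn; exact: leq_addl.
elim: {-2}n => // m IHm; rewrite ltnS leq_eqVlt => /orP[/eqP dm|dm] /=.
  rewrite -dm sigD [X in _ + X]sig_lead => [|e ed]; last first.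
    by rewrite coefZ coefXn (ltn_eqF ed) mulr0.
  by rewrite coefZ coefXn eqxx mulr1 coef_poly ltn_subRL addnC rdn addrC subrK.
rewrite sigD IHm // [X in _ + X]sig_lead => [|e ed]; last first.
  by rewrite coefZ coefXn (ltn_eqF (ltn_trans ed dm)) mulr0.
by rewrite coefZ coefXn (ltn_eqF dm) mulr0 coef0 addr0.
Qed.

End FundamentalSolution.

(** * The overruled cone of a J-function *)

Section Cone.
Variable K : comNzRingType.
Variable v : nat -> nat -> K.
Hypothesis v_q0 : forall r, v r 0%N = (r == 0%N)%:R.
Hypothesis v_01 : v 0%N 1%N = 0.
Local Notation P := {poly {poly K}}.
Local Notation lab := (nat * nat)%type.
Implicit Types (b c : lab) (l s t : seq lab) (p : P).

(* With z set to 1, an element of weight w has its z^0, z^1, ... part in total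
   degree at most w in (h, q), or in (H, q).  The weight of the value at l is
   sumw l + 1 - size l, and m1, m2 shift this bound. *)
Definition supported m1 m2 l p :=
  forall r d, (sumw l + m2 <= r + d + size l + m1)%N -> p`_d`_r = 0.

Definition vanish m1 m2 l (x : nat -> nat -> K) :=
  forall r d, (r + d + size l + m1 < sumw l + m2)%N -> x r d = 0.

(* The nonnegative part of the cone: tau_d H^i stands for (-z)^d H^i, and the
   dilaton shift contributes the value at the empty list. *)
Definition target l r d : K :=
  match l with
  | [::] => ((r == 0%N) && (d == 0%N))%:R
  | [:: b] => (-1) ^+ b.1 * ((r == b.2) && (d == 0%N))%:R
  | _ => 0
  end.

(** One more than the weight, to suit the strict bounds of [solve]. When the weight is negative the
    truncated subtraction gives 0, and the tangent vector is zero. *)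
Definition cutoff l := (sumw l + 2 - size l)%N.

(* cone l is the derivative in the directions l of exp(p / z), and tangent b that
   of p in the direction b, so that cone (b :: l) = conv (tangent b) cone l; here
   tangent b l is the correction that gives cone (b :: l) the nonnegative part
   target (b :: l).  The n-th approximations of tangent b and cone are correct on
   lists of size < n and <= n respectively. *)
Fixpoint cone_upto n : (lab -> seq lab -> P) * (seq lab -> P) :=
  if n is n'.+1 then
    let X := (cone_upto n').1 in let e := (cone_upto n').2 in
    let X' b l := solve v (fun r d =>
      target (b :: l) r d - sig v (conv (X b) (tail_part e) l) r d) (cutoff (b :: l)) in
    (X', fun l => if l is b :: l' then conv (X' b) e l' else 1)
  else (fun _ _ => 0, delta1 1).

Definition tangent b l := (cone_upto (size l).+1).1 b l.
Definition cone l := (cone_upto (size l)).2 l.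

Lemma cone_uptoP n :
  (forall b l, (size l < n)%N -> (cone_upto n.+1).1 b l = (cone_upto n).1 b l) /\
  (forall l, (size l <= n)%N -> (cone_upto n.+1).2 l = (cone_upto n).2 l).
Proof.
elim: n => [|n [IHX IHe]]; first by split=> [//|[]].
have eqX b l : (size l < n.+1)%N -> (cone_upto n.+2).1 b l = (cone_upto n.+1).1 b l.
  move=> ln; apply: eq_solve => r d; congr (_ - sig _ _ _ _).
  by apply: eq_conv_tail => s sl; [apply: IHX | apply: IHe]; exact: leq_trans sl ln.
split=> // -[|b l] ln //=; apply: eq_conv => s sl; [apply: eqX | apply: IHe];
  exact: leq_ltn_trans sl ln.
Qed.

Lemma tangent_upto n b l : (size l < n)%N -> (cone_upto n).1 b l = tangent b l.
Proof.
elim: n => // n IHn; rewrite ltnS leq_eqVlt => /orP[/eqP<- //|ln].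
by rewrite (cone_uptoP n).1 // IHn.
Qed.

Lemma cone_upto_cone n l : (size l <= n)%N -> (cone_upto n).2 l = cone l.
Proof.
elim: n => [|n IHn]; first by case: l.
rewrite leq_eqVlt => /orP[/eqP ln|ln]; first by rewrite /cone ln.
by rewrite (cone_uptoP n).2 // IHn.
Qed.

Lemma cone_nil : cone [::] = 1. Proof. by []. Qed.

Lemma cone_cons b l : cone (b :: l) = conv (tangent b) cone l.
Proof.
rewrite {1}/cone /=; apply: eq_conv => s sl; last exact: cone_upto_cone.
exact: (@tangent_upto (size l).+1).
Qed.

Lemma tangentE b l : tangent b l = solve v (fun r d =>
  target (b :: l) r d - sig v (conv (tangent b) (tail_part cone) l) r d) (cutoff (b :: l)).
Proof.
apply: eq_solve => r d; congr (_ - sig _ _ _ _).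
by apply: eq_conv_tail => s sl; [apply: tangent_upto | apply: cone_upto_cone].
Qed.

Lemma supported_tangent b l : supported 0 2 (b :: l) (tangent b l).
Proof.
by move=> r d rd; rewrite tangentE (deglt_solve _ _) // /cutoff; lia.
Qed.

(** True by construction: [tangent b l] adds to the other terms of [cone (b :: l)] what they lack to
    reach the target. For the empty list, the hypotheses on [v] make it 1 in total degree below
    2. *)
Lemma sig_cone l r d :
  (r + d + size l < sumw l + 2)%N -> sig v (cone l) r d = target l r d.
Proof.
case: l => [|b l] rd.
  rewrite cone_nil sig1 /=.
  by case: r d rd => [|[|r]] [|[|d]] //; rewrite ?v_q0 ?v_01.
rewrite cone_cons conv_tail cone_nil mulr1 sigD {1}tangentE sig_solve //.
  by rewrite subrK.
by rewrite /cutoff ltn_subRL addnC.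
Qed.

Lemma supportedB m1 m2 l p p' :
  supported m1 m2 l p -> supported m1 m2 l p' -> supported m1 m2 l (p - p').
Proof. by move=> sp sp' r d rd; rewrite !coefB sp ?sp' ?subr0. Qed.

Lemma supportedD m1 m2 l p p' :
  supported m1 m2 l p -> supported m1 m2 l p' -> supported m1 m2 l (p + p').
Proof. by move=> sp sp' r d rd; rewrite !coefD sp ?sp' ?addr0. Qed.

Lemma supported0 m1 m2 l : supported m1 m2 l 0.
Proof. by move=> r d _; rewrite !coef0. Qed.

Lemma supported_inj m1 m2 l p :
  supported m1 m2 l p -> vanish m1 m2 l (sig v p) -> p = 0.
Proof.
move=> sp vp; apply: (sig_inj v_q0 (n := (sumw l + m2 - (size l + m1))%N)) => r d rd.
  by apply: sp; lia.
by apply: vp; lia.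
Qed.

(* A tangent vector is determined by its nonnegative part. *)
Lemma conv_cone_inj m1 m2 N (Y : seq lab -> P) :
  (forall l, (sumw l <= N)%N -> supported m1 m2 l (Y l)) ->
  (forall l, (sumw l <= N)%N -> vanish m1 m2 l (sig v (conv Y cone l))) ->
  forall l, (sumw l <= N)%N -> Y l = 0.
Proof.
move=> sY vY l; have [n] := ubnP (size l); elim: n l => // n IHn l ln lN.
apply: (supported_inj (sY l lN)) => r d rd; rewrite -(vY l lN r d rd).
(* The product at [l] is [Y l] plus terms with [Y] at shorter sublists, which are zero by
   induction. *)
congr (sig _ _ _ _); rewrite conv_tail cone_nil mulr1 -[LHS]addr0; congr (_ + _).
rewrite -[LHS](conv0l (tail_part cone) l); apply: eq_conv_perm => s t st.
rewrite mul0r; case: t st => [|c t] st; first by rewrite mulr0.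
have := split_size st; have := split_sumw st => /= stw sts.
rewrite IHn ?mul0r //; lia.
Qed.

(** Equality of the mixed derivatives of p. The product terms in the two second derivatives of the
    exponential agree by [convCA], so the difference times [cone] is a difference of two values of
    [cone] whose targets are both zero. *)
Lemma tangent_swap b c l : tangent b (c :: l) = tangent c (b :: l).
Proof.
pose Y s := tangent b (c :: s) - tangent c (b :: s).
have [m1 m2] := (0%N, (b.1 + b.2 + (c.1 + c.2))%N).
suff /(_ (sumw l) l (leqnn _)) : forall N l, (sumw l <= N)%N -> Y l = 0.
  by move/eqP; rewrite subr_eq0 => /eqP.
move=> N; apply: (@conv_cone_inj 0 (b.1 + b.2 + (c.1 + c.2))) => s _.
  apply: supportedB => r d rd; apply: supported_tangent => //;
  by rewrite !sumw_cons /=; lia.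
move=> r d rd.
have -> : conv Y cone s = cone [:: b, c & s] - cone [:: c, b & s].
  rewrite convBl !cone_cons /=.
  have E b' c' : conv (tangent b') (fun s => cone (c' :: s)) s =
      conv (tangent b') (conv (tangent c') cone) s.
    by apply: eq_conv => // s' _; rewrite cone_cons.
  by rewrite !E convCA; ring.
by rewrite sigB // !sig_cone ?subrr // !sumw_cons /=; lia.
Qed.

Lemma cone_swap b c l : cone [:: b, c & l] = cone [:: c, b & l].
Proof.
rewrite !cone_cons /=; congr (_ + _).
  by apply: eq_conv => // s _; rewrite tangent_swap.
have E b' c' : conv (tangent b') (fun s => cone (c' :: s)) l =
    conv (tangent b') (conv (tangent c') cone) l.
  by apply: eq_conv => // s' _; rewrite cone_cons.
by rewrite !E convCA.
Qed.

Lemma target_perm (l l' : seq lab) r d : perm_eq l l' -> target l r d = target l' r d.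
Proof.
move=> ll'; have [l1|] := leqP (size l) 1.
  by rewrite (perm_small_eq _ ll') // -(perm_size ll').
by move/perm_size: ll'; case: l => [|? [|? ?]] //; case: l' => [|? [|? ?]].
Qed.

Lemma supported_perm m1 m2 l l' p :
  perm_eq l l' -> supported m1 m2 l p -> supported m1 m2 l' p.
Proof. by move=> ll' sp r d; rewrite -(sumw_perm ll') -(perm_size ll'); apply: sp. Qed.

(** Joint induction on the length. For [cone], swaps of the first two directions and permutations of
    the tail suffice; for [tangent], the difference of two values is supported in the nonnegative
    part and has zero image there. *)
Lemma cone_symfun n : symfun n cone.
Proof.
suff: (forall b, symfun n (tangent b)) /\ symfun n cone by case.
have step m : (forall b, symfun m (tangent b)) -> symfun m cone -> symfun m.+1 cone.
  move=> tS eS [|b l]; first by move=> l' _; rewrite perm_sym => /perm_nilP->.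
  have cons_perm b' s s' : (size s <= m)%N -> perm_eq s s' -> cone (b' :: s) = cone (b' :: s').
    by move=> sm ss'; rewrite !cone_cons (conv_sym (tS b') eS _ ss').
  move=> l' lm ll'; have bl' : b \in l' by rewrite -(perm_mem ll') mem_head.
  case/splitPr: bl' ll' => -[|c u] w /= luw.
    by apply: cons_perm; rewrite // -(perm_cons b).
  have mid : perm_eq (b :: (u ++ w)) (u ++ b :: w) by rewrite -cat1s perm_catCA.
  have lcuw : perm_eq l [:: c & u ++ w].
    rewrite -(perm_cons b) (perm_trans luw) // perm_sym (perm_catCA [:: b] [:: c]).
    by rewrite /= perm_cons.
  rewrite (cons_perm b l [:: c & u ++ w]) // cone_swap; apply: cons_perm => //.
  by have := perm_size lcuw; rewrite /= in lm *; lia.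
elim: n => [|n [IHt IHe]].
  have eS : symfun 0 cone.
    by move=> [|//] l' _; rewrite perm_sym => /perm_nilP->.
  by split=> // b [|//] l' _; rewrite perm_sym => /perm_nilP->.
have eS := step n IHt IHe; split=> // b l l' ln ll'; apply/eqP; rewrite -subr_eq0; apply/eqP.
apply: (@supported_inj 1 (b.1 + b.2 + 2) l).
  apply: supportedB.
    move=> r d rd; apply: supported_tangent; rewrite sumw_cons /=; lia.
  apply: (@supported_perm _ _ l'); first by rewrite perm_sym.
  move=> r d rd; apply: supported_tangent; rewrite sumw_cons /=; lia.
move=> r d rd; rewrite sigB //.
have E s : tangent b s = cone (b :: s) - conv (tangent b) (tail_part cone) s.
  by rewrite cone_cons conv_tail cone_nil mulr1 addrK.
rewrite !E; have -> : conv (tangent b) (tail_part cone) l' = conv (tangent b) (tail_part cone) l.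
  (* Truncated to length [n], [tangent b] is symmetric by induction, and on lists of length at most
     [n.+1] a product with [tail_part cone] sees no other values. *)
  pose t' s := if (size s <= n)%N then tangent b s else 0.
  have tS : symfun n.+1 t'.
    by move=> s s' _ ss'; rewrite /t' -(perm_size ss'); case: leqP => // sn; apply: IHt.
  have tlS : symfun n.+1 (tail_part cone).
    move=> [|c s] s' sn ss'; first by move: ss'; rewrite perm_sym => /perm_nilP->.
    by rewrite /= (eS _ _ sn ss'); case: s' ss' => // /perm_size.
  have tE s : (size s <= n.+1)%N ->
      conv (tangent b) (tail_part cone) s = conv t' (tail_part cone) s.
    move=> sn; apply: eq_conv_tail => // s' ss'.
    by rewrite /t' ifT // -ltnS (leq_trans ss').
  by rewrite !tE -?(perm_size ll') // -(conv_sym tS tlS _ ll').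
have [sl swl] := (size_perm ll', sumw_perm ll').
have tE : target (b :: l) r d = target (b :: l') r d.
  by apply: target_perm; rewrite perm_cons.
rewrite !sigB // !sig_cone ?tE ?sumw_cons //=; [ring | lia | lia].
Qed.

Lemma cone_perm l l' : perm_eq l l' -> cone l = cone l'.
Proof. exact: (cone_symfun (leqnn _)). Qed.

Lemma conv_cons_cone b l : conv (tangent b) cone l = cone (b :: l).
Proof. by rewrite cone_cons. Qed.

(** * String and divisor equations on the cone *)

Lemma supported_low k l :
  supported 0 (k + 1) l (low k tangent l).
Proof.
apply: low_ind => [|x y|b s bsl b0]; [exact: supported0 | exact: supportedD |].
apply: (supported_perm bsl) => r d rd; apply: supported_tangent.
by move: rd; rewrite !sumw_cons /lower_lab /=; lia.
Qed.

Lemma low_target k l r d : (1 < size l)%N ->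
  low k (fun a s => target (a :: s) r d) l = 0.
Proof.
move=> l1; apply: (low_ind (Q := fun x : K => x = 0)) => // [x y -> ->|b s bsl _].
  exact: addr0.
by move: l1; rewrite -(size_perm bsl); case: s bsl.
Qed.

Lemma sig_low_cone k l r d : (r + d + size l < sumw l + k + 1)%N ->
  sig v (low k (fun a s => cone (a :: s)) l) r d =
  low k (fun a s => target (a :: s) r d) l.
Proof.
move=> rd; apply: (low_morph (phi := fun p => sig v p r d)) => [|p p'|b s bsl b0].
- exact: sig0.
- exact: sigD.
apply: sig_cone; move: rd; rewrite -(size_perm bsl) -(sumw_perm bsl) !sumw_cons /lower_lab /=; lia.
Qed.

(** Both sides are tangent vectors with the same nonnegative part. Division by z turns (-z)^n H^i
    into minus (-z)^(n-1) H^i, which the lowered term cancels, or for n = 0 into a negative power of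
    z; it turns the dilaton shift into the direction H^0. *)
Lemma cone_string l : cone ((0, 0)%N :: l) = cone l + low_at 0 cone l.
Proof.
pose Y s := delta1 1 s + low 0 tangent s - tangent (0, 0)%N s.
have YE s : conv Y cone s =
    cone s + low 0 (fun a t => cone (a :: t)) s - cone ((0, 0)%N :: s).
  rewrite convBl convDl conv_delta1 mul1r conv_low conv_cons_cone.
  by congr (_ + _ - _); apply: eq_low => a t; rewrite conv_cons_cone.
have Y0 s : Y s = 0.
  apply: (@conv_cone_inj 0 1 (sumw s)) => // t _.
    apply: supportedB; last first.
      by move=> r d rd; apply: supported_tangent; rewrite sumw_cons /=; lia.
    apply: supportedD; last exact: (@supported_low 0).
    case: t => [|b t]; last exact: supported0.
    by move=> [|r] [|d] // _; rewrite ?coef1 //= ?coef1 ?coef0.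
  move=> r d rd; rewrite YE sigB // sigD sig_low_cone ?sig_cone ?sumw_cons /=; try lia.
  case: t rd => [|b [|b' t]] rd; last by rewrite low_target //= addr0 subr0.
    by rewrite /= addr0 ?expr0 mul1r subrr.
  rewrite /= !addr0 subr0; case: b rd => [[|n] i] /= rd; last first.
    by rewrite addn0 exprS mulN1r mulNr addNr.
  rewrite addr0 ?expr0 mul1r; case: eqP => // ri.
  by move: rd; rewrite ri /sumw /=; lia.
have := YE l; rewrite (@eq_conv _ l _ cone (fun=> 0) cone) // conv0l => /esym/eqP.
rewrite subr_eq0 low_lowat; last exact: cone_perm.
by move/eqP.
Qed.

(** The Taylor coefficients of q dp/dq: the exponent p has no constant term, and its derivative in
    direction b is [tangent b]. *)
Definition theta_tangent l : P := if l is b :: l' then theta (tangent b l') else 0.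

Lemma theta_conv (f g : seq lab -> P) l :
  theta (conv f g l) = conv (fun s => theta (f s)) g l + conv f (fun s => theta (g s)) l.
Proof.
elim: l f g => [|b l IHl] f g /=; first exact: thetaM.
by rewrite thetaD !IHl addrACA.
Qed.

Lemma theta_cone l : theta (cone l) = conv theta_tangent cone l.
Proof.
have [n] := ubnP (size l); elim: n l => // n IHn [|b l] ln.
  by rewrite /= cone_nil /theta derivC mulr0 mul0r.
rewrite cone_cons theta_conv /=; congr (_ + _).
rewrite (@eq_conv _ l _ (fun s => theta (cone s)) (tangent b) (conv theta_tangent cone)) //.
  by rewrite convCA; apply: eq_conv => // s _; rewrite cone_cons.
by move=> s sl; apply: IHn; apply: leq_ltn_trans sl ln.
Qed.

(** The operator (h + z q d/dq) / z becomes (H + z q d/dq) / z under [sig]. On targets it turns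
    (-z)^n H^i into minus (-z)^(n-1) H^(i+1), cancelled by the lowered term or a negative power of
    z, and the dilaton shift into H^1. *)
Lemma cone_divisor l :
  'X%:P * cone l + theta (cone l) = cone ((0, 1)%N :: l) - low_at 1 cone l.
Proof.
pose Y s := delta1 'X%:P s + theta_tangent s + low 1 tangent s - tangent (0, 1)%N s.
have YE s : conv Y cone s =
    'X%:P * cone s + theta (cone s) + low 1 (fun a t => cone (a :: t)) s
    - cone ((0, 1)%N :: s).
  rewrite convBl !convDl conv_delta1 conv_low conv_cons_cone theta_cone.
  by congr (_ + _ - _); apply: eq_low => a t; rewrite conv_cons_cone.
have Y0 s : Y s = 0.
  apply: (@conv_cone_inj 0 2 (sumw s)) => // t _.
    apply: supportedB; last first.
      by move=> r d rd; apply: supported_tangent; rewrite sumw_cons /=; lia.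
    apply: supportedD; last exact: (@supported_low 1).
    apply: supportedD.
      case: t => [|b t]; last exact: supported0.
      by move=> [|[|r]] [|d] //= _; rewrite coefC //= ?coef0 ?coefX.
    case: t => [|b t]; first exact: supported0.
    by move=> r d rd; rewrite coef_theta coefMn supported_tangent ?mul0rn //; lia.
  move=> r d rd; rewrite YE sigB // sigD sig_intertwine //.
  rewrite sig_low_cone ?sig_cone ?sumw_cons /=; try lia.
  have -> : (if r is r'.+1 then sig v (cone t) r' d else 0) =
      (if r is r'.+1 then target t r' d else 0).
    by case: r rd => [//|r] rd; rewrite sig_cone //; lia.
  case: t rd => [|b [|b' t]] rd; last first.
  - by rewrite low_target //= mulr0 add0r addr0 subr0; case: r rd.
  - rewrite /= !addr0 subr0; case: b rd => [n i] /= rd.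
    have -> : d%:R * ((-1) ^+ n * ((r == i) && (d == 0%N))%:R) = 0 :> K.
      by case: d rd => [|d] _; rewrite ?mul0r // andbF !mulr0.
    rewrite add0r addn1; case: n rd => [|n] rd /=.
      rewrite addr0; case: r rd => // r rd.
      case: eqP => // ri; last by rewrite mulr0.
      by move: rd; rewrite ri /sumw /=; lia.
    by rewrite exprS mulN1r; case: r rd => [|r] _; rewrite ?mulr0 ?addr0 // eqSS mulNr addNr.
  - rewrite /= addr0 mul1r; case: d rd => [|d] rd; last first.
      by rewrite !andbF mulr0 add0r subr0; case: r rd => // r _; rewrite andbF.
    by rewrite mul0r add0r; case: r rd => [|r] _; rewrite ?subrr ?subr0.
have := YE l; rewrite (@eq_conv _ l _ cone (fun=> 0) cone) // conv0l => /esym/eqP.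
rewrite subr_eq0 low_lowat; last exact: cone_perm.
by move/eqP <-; rewrite addrK.
Qed.

(** * Topological recursion on the cone *)

(* The symbol <l, tau_k H_r> is the coefficient of H^r z^(-k-1) in sig v (cone l);
   homogeneity gives the exponent of q. *)
Definition corr l k r : K :=
  if (r + size l <= sumw l + k + 2)%N
  then sig v (cone l) r (sumw l + k + 2 - size l - r) else 0.

(* <u, l, H_a>, with the power of q that records its degree. *)
Definition kap u a l : P :=
  (corr (u ++ l) 0 a)%:P *: 'X^(sumw (u ++ l) + 2 - size (u ++ l) - a).

Lemma corr_out l k r : (sumw l + k + 2 < r + size l)%N -> corr l k r = 0.
Proof. by rewrite /corr ltnNge => /negbTE->. Qed.

Lemma supported_conv_kap u a l :
  supported (size u) (sumw u + 3) l (conv (kap u a) (tangent (0%N, a)) l).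
Proof.
move=> r d rd; apply: (conv_ind (P := fun p : P => p`_d`_r = 0)) => [x y xP yP|s t st].
  by rewrite !coefD xP yP addr0.
have [out|ok] := ltnP (sumw (u ++ s) + 0 + 2) (a + size (u ++ s)).
  by rewrite /kap corr_out // scale0r mul0r !coef0.
rewrite /kap -scalerAl coefZ coefXnM; case: ltnP => [_|dk]; first by rewrite mulr0 coef0.
rewrite mul_polyC coefZ supported_tangent ?mulr0 //.
move: rd ok dk; rewrite (split_size st) (split_sumw st) !sumw_cons !sumw_cat !size_cat /=; lia.
Qed.

(** As soon as an entry of [l] goes to the second factor, the nonnegative part of that factor is
    zero. What remains is [kap] at [l] times H^a, the target of the direction H^a. *)
Lemma sig_kap_conv u a l r d :
  (r + d + size (u ++ l) < sumw (u ++ l) + 3)%N ->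
  sig v (conv (kap u a) (fun s => cone ((0%N, a) :: s)) l) r d =
  corr (u ++ l) 0 a *
    ((r == a) && (d == sumw (u ++ l) + 2 - size (u ++ l) - a)%N)%:R.
Proof.
move=> rd.
have kapM s p : sig v (kap u a s * p) r d =
    if (sumw (u ++ s) + 2 - size (u ++ s) - a <= d)%N
    then corr (u ++ s) 0 a * sig v p r (d - (sumw (u ++ s) + 2 - size (u ++ s) - a)) else 0.
  exact: sigqM.
rewrite conv_tail sigD // kapM.
rewrite [X in _ + X](_ : _ = 0) ?addr0; last first.
  apply: (conv_ind (P := fun p : P => sig v p r d = 0)) => [x y xP yP|s [|c t] st].
  - by rewrite sigD // xP yP addr0.
  - by rewrite mulr0 sig0.
  rewrite kapM; case: leqP => // kd.
  have [out|ok] := ltnP (sumw (u ++ s) + 0 + 2) (a + size (u ++ s)).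
    by rewrite corr_out // mul0r.
  rewrite sig_cone ?mulr0 //.
  move: rd ok kd; rewrite !sumw_cons !sumw_cat !size_cat.
  by rewrite (split_size st) (split_sumw st) !sumw_cons /=; lia.
have [out|ok] := ltnP (sumw (u ++ l) + 0 + 2) (a + size (u ++ l)).
  by rewrite corr_out // !mul0r if_same.
case: leqP => kd; last by rewrite (ltn_eqF kd) andbF mulr0.
rewrite sig_cone /=; last by rewrite sumw_cons /=; lia.
by rewrite expr0 mul1r subn_eq0 [(d == _)]eqn_leq kd andbT.
Qed.

(* The two tangent vector fields agree because their nonnegative parts do. *)
Lemma topological_recursion u (Z G : seq lab -> P) N l :
  (forall s, supported (size u) (sumw u + 3) s (Z s)) ->
  (forall s, conv Z cone s = G s) ->
  (forall s r d, (r + d + size (u ++ s) < sumw (u ++ s) + 3)%N ->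
     sig v (G s) r d = if (r + d + size (u ++ s) == sumw (u ++ s) + 2)%N
                       then sig v (cone (u ++ s)) r d else 0) ->
  (sumw (u ++ l) + 2 < N)%N ->
  G l = \sum_(a < N) conv (kap u a) (fun s => cone ((0%N, val a) :: s)) l.
Proof.
move=> sZ ZG GP lN.
pose Y s := Z s - \sum_(a < N) conv (kap u a) (tangent (0%N, val a)) s.
have YE s : conv Y cone s =
    G s - \sum_(a < N) conv (kap u a) (fun s => cone ((0%N, val a) :: s)) s.
  rewrite convBl ZG conv_suml; congr (_ - _); apply: eq_bigr => a _.
  by rewrite -convA; apply: eq_conv => // s' _; rewrite cone_cons.
have Y0 s : (sumw s <= sumw l)%N -> Y s = 0.
  apply: conv_cone_inj => t tl.
    apply: supportedB; first exact: sZ.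
    elim/big_ind: _ => [|x y|a _]; first exact: supported0.
      exact: supportedD.
    exact: supported_conv_kap.
  move=> r d rd.
  have rd' : (r + d + size (u ++ t) < sumw (u ++ t) + 3)%N.
    by rewrite size_cat sumw_cat; lia.
  rewrite YE sigB // sig_sum // GP //.
  under eq_bigr do rewrite sig_kap_conv //.
  (* The edge is the coefficient of z^(-1) in [cone (u ++ t)]; there only a = r contributes, with
     the invariant itself. Off the edge the exponent of q in [kap] excludes every term. *)
  have [edge|notedge] := eqVneq (r + d + size (u ++ t))%N (sumw (u ++ t) + 2)%N.
    have rN : (r < N)%N by move: lN; rewrite sumw_cat => lN; rewrite sumw_cat in edge; lia.
    rewrite (bigD1 (Ordinal rN)) //= big1 => [|a]; last first.
      by rewrite -val_eqE /= eq_sym => /negbTE->; rewrite mulr0.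
    have dE : (d = sumw (u ++ t) + 2 - size (u ++ t) - r)%N by lia.
    by rewrite eqxx -dE eqxx mulr1 addr0 /corr ifT; [rewrite addn0 -dE subrr | lia].
  rewrite big1 ?subr0 // => a _.
  have [out|ok] := ltnP (sumw (u ++ t) + 0 + 2) (a + size (u ++ t)).
    by rewrite corr_out // mul0r.
  case: eqP => [ra|]; last by rewrite mulr0.
  case: eqP => [dE|]; last by rewrite mulr0.
  by move/eqP: notedge; case; rewrite ra dE; lia.
apply/eqP; rewrite -subr_eq0 -YE -[X in _ == X](conv0l cone l); apply/eqP.
apply: eq_conv_perm => s t st; rewrite Y0 //.
by rewrite (split_sumw st) leq_addr.
Qed.

(** Up to the factor exp(p / z), z times the second derivative of the cone is z p_bc + p_b p_c,
    hence a tangent vector. As targets vanish on two or more entries, its nonnegative part is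
    constant in z and consists of the invariants <b, c, ..., H_a>. *)
Lemma cone_trr2 b c l N : (sumw [:: b, c & l] + 2 < N)%N ->
  cone [:: b, c & l] =
  \sum_(a < N) conv (kap [:: b; c] a) (fun s => cone ((0%N, val a) :: s)) l.
Proof.
move=> lN; pose Z s := tangent c (b :: s) + conv (tangent c) (tangent b) s.
apply: (@topological_recursion [:: b; c] Z (fun s => cone [:: b, c & s]) N l) => //.
- move=> s; apply: supportedD => r d rd.
    by apply: supported_tangent; move: rd; rewrite !sumw_cons /=; lia.
  apply: (conv_ind (P := fun p : P => p`_d`_r = 0)) => [x y xP yP|t t' tt'].
    by rewrite !coefD xP yP addr0.
  have nz b' t0 : deglt (sumw (b' :: t0) + 2 - size (b' :: t0)) (tangent b' t0).
    by move=> r' d' rd'; apply: supported_tangent; lia.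
  (* Where the truncated bound is 0 the factor vanishes; elsewhere the subtraction is exact and
     [degltM] gives the required bound. *)
  have nz0 b' t0 : (sumw (b' :: t0) + 2 <= size (b' :: t0))%N -> tangent b' t0 = 0.
    by move=> out; apply: deglt0 => r' d' _; apply: nz; lia.
  have [/nz0-> |okc] := leqP (sumw (c :: t) + 2) (size (c :: t)).
    by rewrite mul0r !coef0.
  have [/nz0-> |okb] := leqP (sumw (b :: t') + 2) (size (b :: t')).
    by rewrite mulr0 !coef0.
  apply: (degltM (nz c t) (nz b t')); move: okc okb.
  by move: rd; rewrite (split_size tt') (split_sumw tt') !sumw_cons /=; lia.
- move=> s; rewrite convDl -convA cone_swap [RHS]cone_cons /=; congr (_ + _).
  by apply: eq_conv => // t _; rewrite cone_cons.
- move=> s r d rd; case: eqP => // edge; rewrite sig_cone //.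
  by move: rd edge; rewrite /= !sumw_cons /=; lia.
Qed.

(** The target of tau_(n+1) H^j and z times that of tau_n H^j cancel. The nonnegative part left is
    the coefficient of z^(-1) in the derivative along tau_n H^j, raised by one power of z. *)
Lemma cone_trr1 n j l N : (sumw ((n, j) :: l) + 2 < N)%N ->
  cone ((n.+1, j) :: l) + cone ((n, j) :: l) =
  \sum_(a < N) conv (kap [:: (n, j)] a) (fun s => cone ((0%N, val a) :: s)) l.
Proof.
move=> lN; pose Z s := tangent (n.+1, j) s + tangent (n, j) s.
apply: (@topological_recursion [:: (n, j)] Z
  (fun s => cone ((n.+1, j) :: s) + cone ((n, j) :: s)) N l) => //.
- move=> s; apply: supportedD => r d rd;
  by apply: supported_tangent; move: rd; rewrite !sumw_cons /=; lia.
- by move=> s; rewrite convDl !conv_cons_cone.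
move=> s r d; rewrite /= !sumw_cons /= => rd.
rewrite sigD // sig_cone ?sumw_cons /=; last by lia.
have [edge|notedge] := eqVneq (r + d + (size s).+1)%N (n + j + sumw s + 2)%N; last first.
  rewrite sig_cone ?sumw_cons /=; last by lia.
  by case: s rd notedge => [|c s] *; rewrite ?addr0 // exprS mulN1r mulNr addNr.
case: s rd edge => [|c s] rd edge; last by rewrite add0r.
rewrite (_ : _ && _ = false) ?mulr0 ?add0r //; apply/negP => /andP[/eqP ri /eqP d0].
by move: edge; rewrite ri d0 /sumw /=; lia.
Qed.

(** In [cone_trr1] at [c :: l], the terms with [c] in the first factor sum to [cone
    [:: (n, j), c & l]] by [cone_trr2]; cancelling them leaves [c] in the second factor. *)
Lemma cone_trr n j c l N : (sumw [:: (n, j), c & l] + 2 < N)%N ->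
  cone [:: (n.+1, j), c & l] =
  \sum_(a < N) conv (kap [:: (n, j)] a) (fun s => cone [:: (0%N, val a), c & s]) l.
Proof.
move=> lN; have := cone_trr1 lN; rewrite (cone_trr2 lN) big_split /=.
by rewrite addrC; apply: addIr.
Qed.

(** * The equations for the invariants *)

Lemma sig_kap_corr u w a l k r d :
  (d + r + size (u ++ w) + size l + a = sumw (u ++ w) + sumw l + k + 4)%N ->
  sig v (conv (kap u a) (fun s => cone (w ++ s)) l) r d =
  conv (fun s => corr (u ++ s) 0 a) (fun s => corr (w ++ s) k r) l.
Proof.
move=> dE; apply: (conv_morph (phi := fun p => sig v p r d)) => [p p'|s t st].
  exact: sigD.
rewrite /kap sigqM //.
have [out|ok] := ltnP (sumw (u ++ s) + 0 + 2) (a + size (u ++ s)).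
  by rewrite corr_out // !mul0r if_same.
move: dE ok; rewrite (split_size st) (split_sumw st) !sumw_cat !size_cat => dE ok.
rewrite [X in _ = _ * X]/corr sumw_cat size_cat.
case: leqP => h1; case: leqP => h2; rewrite ?mulr0 //; try lia.
by congr (_ * sig _ _ _ _); lia.
Qed.

Lemma corr_perm l l' k r : perm_eq l l' -> corr l k r = corr l' k r.
Proof. by move=> ll'; rewrite /corr (cone_perm ll') (size_perm ll') (sumw_perm ll'). Qed.

Lemma corr_trr_last b c l k r N : (sumw [:: b, c & l] + 2 < N)%N ->
  (r + size [:: b, c & l] <= sumw [:: b, c & l] + k.+1 + 2)%N ->
  corr [:: b, c & l] k.+1 r =
  \sum_(a < N) conv (fun s => corr [:: b, c & s] 0 a) (fun s => corr ((0%N, val a) :: s) k r) l.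
Proof.
move=> lN lr; rewrite /corr lr (cone_trr2 lN) sig_sum //; apply: eq_bigr => a _.
apply: (@sig_kap_corr [:: b; c] [:: (0%N, val a)]).
by move: lr; rewrite /= !sumw_cons /sumw /= -/(sumw l); lia.
Qed.

Lemma corr_trr_first n j c l k r N : (sumw [:: (n, j), c & l] + 2 < N)%N ->
  (r + size [:: (n.+1, j), c & l] <= sumw [:: (n.+1, j), c & l] + k + 2)%N ->
  corr [:: (n.+1, j), c & l] k r =
  \sum_(a < N) conv (fun s => corr ((n, j) :: s) 0 a)
                    (fun s => corr [:: (0%N, val a), c & s] k r) l.
Proof.
move=> lN lr; rewrite /corr lr (cone_trr lN) sig_sum //; apply: eq_bigr => a _.
apply: (@sig_kap_corr [:: (n, j)] [:: (0%N, val a); c]).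
by move: lr; rewrite /= !sumw_cons /sumw /= -/(sumw l); lia.
Qed.

Lemma sig_low_at k m r l d : (d + r + size l = sumw l + k + m + 1)%N ->
  sig v (low_at k cone l) r d = low_at k (fun s => corr s m r) l.
Proof.
move=> dE; apply: (low_at_morph (phi := fun p => sig v p r d)) => [|p p'|s sl swl].
- exact: sig0.
- exact: sigD.
by rewrite /corr ifT; [congr (sig _ _ _ _); lia | lia].
Qed.

Lemma corr_string l k r : (r + size l < sumw l + k + 2)%N ->
  ~ (exists i, l = [:: (0, i)]%N /\ (k, r) = (0, i)%N) ->
  corr ((0, 0)%N :: l) k r =
  low_at 0 (fun s => corr s k r) l + (if (0 < k)%N then corr l k.-1 r else 0).
Proof.
move=> lr nex; rewrite {1}/corr ifT /=; last by rewrite ?sumw_cons /=; lia.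
rewrite cone_string sigD addrC (@sig_low_at 0 k) //; last by rewrite ?sumw_cons /=; lia.
congr (_ + _); case: k lr nex => [|k] lr nex /=; last first.
  by rewrite /corr ifT ?sumw_cons /=; [congr (sig _ _ _ _); lia | lia].
(* For [k = 0] the coefficient of [cone l] lies in the nonnegative part, so it is given by the
   target; it is zero except for the excluded symbols <H^0, H^i, H_i>. *)
rewrite sig_cone ?sumw_cons /=; last by lia.
case: l lr nex => [|b [|//]] lr nex /=.
  by rewrite addn0 in lr; case: r lr nex => [|[|r]].
case: eqP => [ri|]; last by rewrite mulr0.
case: b ri lr nex => [[|n] i] /= ri lr nex; first by case: nex; exists i; rewrite ri.
by rewrite (_ : _ == 0%N = false) ?mulr0 //; rewrite ri /sumw /=; lia.
Qed.

Lemma corr_divisor l k r : (r + size l < sumw l + k + 2)%N ->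
  corr ((0, 1)%N :: l) k r =
  (sumw l + k + 2 - size l - r)%:R * corr l k r + low_at 1 (fun s => corr s k r) l
  + (if (0 < k)%N && (0 < r)%N then corr l k.-1 r.-1 else 0).
Proof.
move=> lr; have coneE : cone ((0, 1)%N :: l) =
    'X%:P * cone l + theta (cone l) + low_at 1 cone l by rewrite cone_divisor subrK.
rewrite {1}/corr ifT /=; last by rewrite ?sumw_cons /=; lia.
rewrite {}coneE sigD sig_intertwine // addrAC (@sig_low_at 1 k); last by rewrite ?sumw_cons /=; lia.
set d := (_ - _)%N; have dE : d = (sumw l + k + 2 - size l - r)%N.
  by rewrite /d sumw_cons /=; lia.
rewrite /corr ifT -?dE; last by lia.
rewrite addrAC -!addrA; congr (_ + _); rewrite addrC; congr (_ + _).
case: r lr d dE => [|r] lr d dE; first by rewrite andbF.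
rewrite andbT; case: k lr d dE => [|k] lr d dE /=.
  (* For [k = 0] the term coming from multiplication by H lies in the nonnegative part, where it is
     zero because the exponent [d] of q is positive. *)
  rewrite sig_cone; last by lia.
  case: l lr d dE => [|b [|//]] lr d dE /=; rewrite (_ : d == 0%N = false) ?andbF ?mulr0 //.
    by apply/negbTE; rewrite -lt0n; lia.
  by apply/negbTE; rewrite -lt0n; lia.
by rewrite ifT; [congr (sig _ _ _ _); lia | lia].
Qed.

(** * Invariants of degree zero *)

Definition sumpsi l := sumn [seq b.1 | b <- l].
Definition sumdeg l := sumn [seq b.2 | b <- l].
Definition flat l : seq lab := [seq (b.1, 0%N) | b <- l].

Lemma sumwE l : sumw l = (sumpsi l + sumdeg l)%N.
Proof. by elim: l => // b l IHl; rewrite sumw_cons IHl /sumpsi /sumdeg /=; lia. Qed.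

Lemma sumdeg_flat l : sumdeg (flat l) = 0%N.
Proof. by elim: l. Qed.

Lemma sumpsi_flat l : sumpsi (flat l) = sumpsi l.
Proof. by rewrite /sumpsi -map_comp. Qed.

Lemma conv_map (R : comNzRingType) (h : lab -> lab) (f g : seq lab -> R) l :
  conv f g (map h l) = conv (fun s => f (map h s)) (fun s => g (map h s)) l.
Proof. by elim: l f g => [|b l IHl] f g //=; rewrite !IHl. Qed.

Lemma conv_monomial (f g f' g' : seq lab -> P) i l :
  (forall s t : seq lab, perm_eq (s ++ t) l ->
    (f s * g t)`_0 = (f' (flat s) * g' (flat t))`_0`_0 *: 'X^(i + sumdeg s + sumdeg t)) ->
  (conv f g l)`_0 = (conv f' g' (flat l))`_0`_0 *: 'X^(i + sumdeg l).
Proof.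
move=> fg; pose c := conv (fun s => f' (flat s)) (fun s => g' (flat s)) l.
rewrite -[conv f' g' _]/(conv f' g' (map _ l)) conv_map -/(flat _) -/c.
pose F s : {poly K} := (f s)`_0; pose G s : {poly K} := (g s)`_0.
have -> : (conv f g l)`_0 = conv F G l.
  apply: (conv_morph (phi := fun p : P => p`_0)) => [p p'|s t _]; first exact: coefD.
  by rewrite coefM big_ord1.
have -> : c`_0`_0 = conv (fun s => (f' (flat s))`_0`_0) (fun s => (g' (flat s))`_0`_0) l.
  apply: (conv_morph (phi := fun p : P => p`_0`_0)) => [p p'|s t _].
    by rewrite !coefD.
  by rewrite coefM big_ord1 subnn coefM big_ord1.
symmetry; apply: (conv_morph (phi := fun x : K => x *: 'X^(i + sumdeg l))) => [x y|s t st].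
  exact: scalerDl.
have -> : sumdeg l = (sumdeg s + sumdeg t)%N.
  by rewrite /sumdeg -sumn_cat -map_cat; apply/perm_sumn/perm_map; rewrite perm_sym.
rewrite addnA; have := fg s t st; rewrite [in X in X -> _]coefM big_ord1 subnn => ->.
by rewrite coefM big_ord1 subnn coefM big_ord1.
Qed.

(** At q = 0 the targets are monomials in H whose coefficients depend on the psi classes alone, and
    products add the exponents. The bound on the nonnegative part, read at the exponent [sumdeg],
    involves only the psi classes and the number of entries. *)
Lemma cone_monomial l : (cone l)`_0 = (cone (flat l))`_0`_0 *: 'X^(sumdeg l).
Proof.
have prod_mono (p p' : P) (c c' : P) i j : p`_0 = c`_0`_0 *: 'X^i -> p'`_0 = c'`_0`_0 *: 'X^j ->
    (p * p')`_0 = (c * c')`_0`_0 *: 'X^(i + j).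
  move=> pE pE'; rewrite coefM big_ord1 subnn pE pE'.
  rewrite coefM big_ord1 subnn coefM big_ord1 subnn.
  by rewrite -scalerAl -scalerAr scalerA exprD.
suff: forall n, (forall b l, (size l < n)%N -> (tangent b l)`_0 =
    (tangent (b.1, 0%N) (flat l))`_0`_0 *: 'X^(b.2 + sumdeg l)) /\
    (forall l, (size l <= n)%N -> (cone l)`_0 = (cone (flat l))`_0`_0 *: 'X^(sumdeg l)).
  by move=> /(_ (size l))[_]; apply.
elim=> [|n [IHt IHe]].
  split=> // -[|//] _; rewrite /flat /= cone_nil.
  have -> : (1 : P)`_0 = 1 by rewrite coef1.
  by rewrite coef1 scale1r expr0.
have T b s : (size s < n.+1)%N -> (tangent b s)`_0 =
    (tangent (b.1, 0%N) (flat s))`_0`_0 *: 'X^(b.2 + sumdeg s).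
  move=> sn.
  have tailE : (conv (tangent b) (tail_part cone) s)`_0 =
      (conv (tangent (b.1, 0%N)) (tail_part cone) (flat s))`_0`_0 *: 'X^(b.2 + sumdeg s).
    apply: conv_monomial => s' t st; have := split_size st => sz.
    case: t st sz => [|c t] st sz; first by rewrite !mulr0 coef0 coef0 scale0r.
    rewrite /= in sz; apply: prod_mono; first by apply: IHt; lia.
    by apply: IHe => /=; lia.
  have E b' s' : tangent b' s' = cone (b' :: s') - conv (tangent b') (tail_part cone) s'.
    by rewrite cone_cons conv_tail cone_nil mulr1 addrK.
  have lead b' s' r : (r + size (b' :: s') < sumw (b' :: s') + 2)%N ->
      (tangent b' s')`_0`_r =
      target (b' :: s') r 0 - (conv (tangent b') (tail_part cone) s')`_0`_r.
    move=> rd; rewrite E coefB coefB -(@sig_lead _ v) //; congr (_ - _).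
    by apply: sig_cone; lia.
  apply/polyP => r; rewrite coefZ coefXn.
  have [rs|rs] := ltnP (r + size (b :: s)) (sumw (b :: s) + 2); last first.
    rewrite supported_tangent; last by lia.
    case: eqP => [rE|]; last by rewrite mulr0.
    rewrite supported_tangent ?mul0r // sumw_cons sumwE sumpsi_flat sumdeg_flat /= size_map.
    by move: rs; rewrite sumw_cons sumwE /=; lia.
  rewrite lead // tailE coefZ coefXn; case: eqP => [rE|rE].
    rewrite !mulr1 lead; last first.
      rewrite sumw_cons sumwE sumpsi_flat sumdeg_flat /= size_map.
      by move: rs; rewrite sumw_cons sumwE /=; lia.
    congr (_ - _); case: s rE {sn tailE rs} => [|//] /=; rewrite /sumdeg /= addn0.
    by move=> ->; rewrite eqxx.
  rewrite mulr0 subr0 mulr0; case: s rE {sn tailE rs} => [|//] /=; rewrite /sumdeg /= addn0.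
  by move/eqP/negbTE=> ->; rewrite mulr0.
split=> // -[|b s] sn; first exact: IHe.
rewrite [cone (b :: s)]cone_cons [cone (flat _)]cone_cons.
apply: conv_monomial => s' t st; have := split_size st => sz; rewrite /= in sn.
by apply: prod_mono; [apply: T; lia | apply: IHe; lia].
Qed.

Definition psi_fact l := (\prod_(b <- l) b.1`!)%N.

(** Lowering an entry with d psi classes divides [psi_fact] by d, so its term contributes d times
    [A]. This is Pascal's rule for multinomial coefficients. *)
Lemma low_at_psi_fact (f : seq lab -> K) A l :
  (forall s, size s = size l -> (sumpsi s).+1 = sumpsi l -> sumdeg s = sumdeg l ->
     f s * (psi_fact s)%:R = A) ->
  low_at 0 f l * (psi_fact l)%:R = (sumpsi l)%:R * A.
Proof.
rewrite /psi_fact; elim: l f => [|b l IHl] f fA /=; first by rewrite /sumpsi !mul0r.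
rewrite mulrDl big_cons natrM /sumpsi /= natrD mulrDl; congr (_ + _).
  case: b fA => [[|n] i] fA /=; first by rewrite !mul0r.
  rewrite -(fA (lower_lab 0 (n.+1, i) :: l)) //=; last by rewrite /sumdeg /= addn0.
  by rewrite big_cons /= factS !natrM; ring.
rewrite mulrA -(IHl (fun s => f (b :: s) * (b.1`!)%:R)); last first.
  move=> s sz sp sd; rewrite -mulrA -natrM -(fA (b :: s)) ?big_cons //=.
  - by rewrite sz.
  - by rewrite /sumpsi /= -/(sumpsi s) -/(sumpsi l) -sp addnS.
  - by rewrite /sumdeg /= -/(sumdeg s) -/(sumdeg l) sd.
congr (_ * _); apply: (low_at_morph (phi := fun x : K => x * (b.1`!)%:R)) => //.
  exact: mul0r.
by move=> x y; exact: mulrDl.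
Qed.

(** Some entry carries no psi class. By [cone_monomial] its cohomology class may be replaced by H^0,
    which the string equation removes; the resulting recursion is Pascal's rule. *)
Lemma cone_multinomial l k : size l = (sumpsi l + k + 2)%N ->
  (cone l)`_0`_(sumdeg l) * (psi_fact l * k`!)%:R = ((sumpsi l + k)`!)%:R.
Proof.
have [n] := ubnP (size l); elim: n l k => // n IHn l k ln lk.
have /hasP[b bl /eqP b0] : has (fun b : lab => b.1 == 0%N) l.
  (* Otherwise there would be at least as many psi classes as entries. *)
  rewrite -[has _ _]negbK -all_predC; apply/negP => /allP l0.
  suff : (size l <= sumpsi l)%N by lia.
  elim: l l0 {ln lk} => // b l IHl l0; rewrite /sumpsi /= -/(sumpsi l).
  have := l0 b (mem_head _ _); rewrite /= -lt0n => b0.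
  by rewrite -add1n leq_add // IHl // => c cl; apply: l0; rewrite inE cl orbT.
pose l' : seq lab := rem b l; have ll' : perm_eq l (b :: l') by exact: perm_to_rem.
have sdl : sumdeg l = (b.2 + sumdeg l')%N by apply: (perm_sumn (perm_map _ ll')).
have spl : sumpsi l = sumpsi l'.
  by rewrite /sumpsi (perm_sumn (perm_map _ ll')) /= b0.
have pfl : psi_fact l = psi_fact l'.
  by rewrite /psi_fact (perm_big _ ll') /= big_cons b0 mul1n.
have szl : size l = (size l').+1 by rewrite (size_perm ll').
have -> : (cone l)`_0`_(sumdeg l) = (cone ((0, 0)%N :: l'))`_0`_(sumdeg l').
  rewrite (cone_perm ll') cone_monomial [in RHS]cone_monomial sdl /flat /= b0.
  by rewrite !coefZ !coefXn (_ : sumdeg ((0, 0)%N :: l') = sumdeg l') // !eqxx.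
move: lk ln; rewrite spl pfl szl => lk ln; clear ll' sdl spl pfl szl; clearbody l'; clear b bl b0 l.
rewrite cone_string !coefD mulrDl.
have lowE : (low_at 0 cone l')`_0`_(sumdeg l') =
    low_at 0 (fun s => (cone s)`_0`_(sumdeg l')) l'.
  apply: (low_at_morph (phi := fun p : P => p`_0`_(sumdeg l'))) => // [|p p'].
    by rewrite !coef0.
  by rewrite !coefD.
have -> : (low_at 0 cone l')`_0`_(sumdeg l') * (psi_fact l' * k`!)%:R =
    (sumpsi l')%:R * (((sumpsi l' + k).-1)`!)%:R.
  rewrite lowE natrM mulrA mulrAC.
  have -> : low_at 0 (fun s => (cone s)`_0`_(sumdeg l')) l' * (k`!)%:R =
      low_at 0 (fun s => (cone s)`_0`_(sumdeg l') * (k`!)%:R) l'.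
    apply: (low_at_morph (phi := fun x : K => x * (k`!)%:R)) => //; first exact: mul0r.
    by move=> x y; exact: mulrDl.
  apply: low_at_psi_fact => s sz sp sd; rewrite -mulrA -natrM mulnC -sd IHn; last 2 first.
  - by rewrite sz.
  - lia.
  by congr ((_`!)%:R); lia.
(* For [k = 0] the first term is a coefficient in the nonnegative part: 1 for a single entry without
   psi class, 0 otherwise. *)
case: k lk {lowE} => [|k] lk.
  case: l' ln lk => [|b [|c l']] ln lk; first by rewrite /sumpsi /= in lk.
    move: lk; rewrite /sumpsi /= => lk; have b0 : b.1 = 0%N by lia.
    rewrite -(@sig_lead _ v) // sig_cone; last by rewrite sumwE /sumpsi /sumdeg /= b0; lia.
    by rewrite /psi_fact big_seq1 /sumdeg /= b0 !addn0 !eqxx !mul1r mul0r addr0.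
  rewrite -(@sig_lead _ v) // sig_cone; last by rewrite sumwE; lia.
  rewrite mul0r add0r addn0 -natrM.
  have : (0 < sumpsi [:: b, c & l'])%N by rewrite /= in lk; lia.
  by case: (sumpsi _).
have -> : (psi_fact l' * k.+1`!)%:R = (psi_fact l' * k`!)%:R * k.+1%:R :> K.
  by rewrite -natrM factS; congr (_%:R); lia.
rewrite mulrA IHn; [| lia | lia].
by rewrite addnS /= factS -!natrM -natrD; congr (_%:R); lia.
Qed.

Lemma corr_multinomial l k r : (r + size l = sumw l + k + 2)%N -> size l = (sumpsi l + k + 2)%N ->
  corr l k r * (psi_fact l * k`!)%:R = ((sumpsi l + k)`!)%:R.
Proof.
move=> rl lk; rewrite -cone_multinomial // /corr ifT; last by lia.
have [-> ->] : (sumw l + k + 2 - size l - r)%N = 0%N /\ r = sumdeg l.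
  by move: rl; rewrite sumwE => rl; lia.
by rewrite sig_lead.
Qed.

Lemma corr_deg0 l k r : (r + size l = sumw l + k + 2)%N -> size l <> (sumpsi l + k + 2)%N ->
  corr l k r = 0.
Proof.
move=> rl lk; rewrite /corr ifT; last by lia.
have -> : (sumw l + k + 2 - size l - r)%N = 0%N by lia.
rewrite sig_lead // cone_monomial coefZ coefXn.
case: eqP => [rE|]; last by rewrite mulr0.
by move: rl; rewrite sumwE; lia.
Qed.

End Cone.

(** * The J-function with prescribed invariants a_ij *)

Section PrescribedInvariants.
Variable K : comNzRingType.
Variable inv : nat -> K.
Hypothesis invP : forall d, (0 < d)%N -> d%:R * inv d = 1.
Variable a : nat -> nat -> K.
Hypothesis a00 : a 0 0 = 0.

(* The coefficient of H^r q^d in u_j, with fuel n: each recursive call decreases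
   2 * r + d - j. *)
Fixpoint flat_upto (n j r d : nat) : K :=
  if d == 0%N then (r == j)%:R else if (r + d <= j)%N then 0 else
  if n is n'.+1 then
    inv d * (flat_upto n' j.+1 r d - (if r is r'.+1 then flat_upto n' j r' d else 0)
      + \sum_(i < j.+1) if (j.+1 - i <= d)%N
                        then a i j * flat_upto n' i r (d - (j.+1 - i)) else 0)
  else 0.

Lemma flat_upto_eq m n j r d : (2 * r + d <= m + j)%N -> (2 * r + d <= n + j)%N ->
  flat_upto m j r d = flat_upto n j r d.
Proof.
have out n' j' r' d' : (2 * r' + d' <= 0 + j')%N ->
    flat_upto n' j' r' d' = if d' == 0%N then (r' == j')%:R else 0.
  by move=> rj; case: n' => [|n'] /=; case: eqP => // _; rewrite ifT //; lia.
elim: m n j r d => [|m IHm] n j r d mj nj; first by rewrite !out.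
case: n nj => [|n] nj; first by rewrite !out.
rewrite /=; case: eqP => // /eqP d0; case: leqP => // jrd.
congr (_ * (_ - _ + _)); first by apply: IHm; lia.
  by case: r mj nj jrd => // r mj nj jrd; apply: IHm; lia.
apply: eq_bigr => i _; have := ltn_ord i => ij.
by case: leqP => // di; congr (_ * _); apply: IHm; lia.
Qed.

Definition flat_coef (j r d : nat) := flat_upto (2 * r + d) j r d.

Lemma flat_coef_q0 j r : flat_coef j r 0 = (r == j)%:R.
Proof. by rewrite /flat_coef; case: (_ + _)%N. Qed.

Lemma flat_coef_low j r d : (0 < d)%N -> (r + d <= j)%N -> flat_coef j r d = 0.
Proof.
rewrite lt0n => /negbTE d0 rj; rewrite /flat_coef.
by case: (_ + _)%N => [|n] /=; rewrite d0 rj.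
Qed.

(** The coefficient of H^r q^d in the differential system. For d > 0 and r + d > j it is the
    recursion multiplied by d; in the other cases the leading terms determine both sides. *)
Lemma flat_coefP j r d :
  d%:R * flat_coef j r d + (if r is r'.+1 then flat_coef j r' d else 0) =
  flat_coef j.+1 r d + \sum_(i < j.+1)
    (if (j.+1 - i <= d)%N then a i j * flat_coef i r (d - (j.+1 - i)) else 0).
Proof.
have [->|d0] := eqVneq d 0%N.
  rewrite mul0r add0r big1 => [|i _]; last by rewrite leqn0 subn_eq0 leqNgt ltn_ord.
  by rewrite addr0 flat_coef_q0; case: r => [|r] //; rewrite flat_coef_q0.
have dpos : (0 < d)%N by rewrite lt0n.
have [rj|rj] := leqP (r + d) j.
  rewrite !flat_coef_low //; last exact: leqW.
  rewrite mulr0 !add0r big1 => [|i _]; last first.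
    have ij := ltn_ord i; case: leqP => // di.
    have [d'0|d'0] := posnP (d - (j.+1 - i)).
      by rewrite d'0 flat_coef_q0 (_ : r == i :> nat = false) ?mulr0 //; apply/eqP; lia.
    by rewrite flat_coef_low ?mulr0 //; lia.
  by case: r rj => // r rj; rewrite flat_coef_low //; lia.
have [n nE] : exists n, (2 * r + d = n.+1)%N by exists (2 * r + d).-1; lia.
rewrite {1}/flat_coef nE /= (negbTE d0) leqNgt rj /= mulrA invP // mul1r.
have -> : (if r is r'.+1 then flat_coef j r' d else 0) =
    (if r is r'.+1 then flat_upto n j r' d else 0).
  by case: r nE rj => // r nE rj; apply: flat_upto_eq; lia.
rewrite addrAC subrK; congr (_ + _); first by apply: flat_upto_eq; lia.
apply: eq_bigr => i _; have ij := ltn_ord i.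
by case: leqP => // di; congr (_ * _); apply: flat_upto_eq; lia.
Qed.

Let v := flat_coef 0.

Lemma flat_coef0_q0 r : v r 0 = (r == 0%N)%:R.
Proof. exact: flat_coef_q0. Qed.

Lemma flat_coef0_01 : v 0 1 = 0.
Proof.
rewrite /v; have := flat_coefP 0 0 1; rewrite mul1r addr0 => ->.
by rewrite big_ord1 /= a00 mul0r addr0 flat_coef_low.
Qed.

(** The system obtains u_(j+1) from u_j by H + q d/dq, which is h + q d/dq before [sig], and by
    subtraction of q-multiples of earlier series. So each u_j is the image of a polynomial of total
    degree at most j. *)
Lemma sig_flat N : exists p : nat -> {poly {poly K}}, forall j, (j <= N)%N ->
  deglt j.+1 (p j) /\ forall r d, sig v (p j) r d = flat_coef j r d.
Proof.
elim: N => [|N [p pP]].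
  exists (fun=> 1) => j; rewrite leqn0 => /eqP->; split; last exact: sig1.
  by move=> [|r] [|d] // _; rewrite coef1 /= ?coef1 ?coef0.
pose p' := 'X%:P * p N + theta (p N) - \sum_(i < N.+1) (a i N)%:P *: 'X^(N.+1 - i) * p i.
exists (fun j => if j == N.+1 then p' else p j) => j jN.
have [->|jN'] := eqVneq j N.+1; last first.
  by apply: pP; rewrite -ltnS ltn_neqAle jN'.
have [degN sigN'] := pP N (leqnn N); split=> [r d rd|r d]; last first.
  rewrite sigB ?sig_intertwine; last exact: flat_coef_q0.
  rewrite sig_sum; last exact: flat_coef_q0.
  under eq_bigr => i _ do rewrite sigqM (pP i (ltn_ord i)).2.
  rewrite sigN'.
  have -> : (if r is r'.+1 then sig v (p N) r' d else 0) =
    (if r is r'.+1 then flat_coef N r' d else 0) by case: r.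
  by rewrite flat_coefP addrK.
rewrite !coefB !coefD mul_polyC coefZ coefXM coef_theta coefMn (degN r d).
  2: by lia.
rewrite mul0rn addr0.
rewrite !coef_sum big1 ?subr0 => [|i _].
  by case: r rd => //= r rd; apply: degN; lia.
have ij := ltn_ord i; rewrite -scalerAl coefZ coefXnM.
case: ltnP => di; first by rewrite mulr0 coef0.
by rewrite mul_polyC coefZ (pP i _).1 ?mulr0 //; lia.
Qed.

(** The divisor equation gives (j + 1 - i) <H^j, H_i>. As u_j and the image of [cone v [:: (0, j)]]
    have the same nonnegative part, <H^j, H_i> is the coefficient of H^i q^(j+1-i) in u_j, and the
    differential system identifies the product with a_ij. *)
Lemma corr_prescribed i j : (i <= j)%N ->
  corr v [:: (0, 1); (0, j)]%N 0 i = a i j.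
Proof.
have [v0 v1] := (flat_coef0_q0, flat_coef0_01).
move=> ij; rewrite corr_divisor //; last by rewrite /sumw /=; lia.
rewrite /= !addr0; have [p /(_ j (leqnn j))[degp sigp]] := sig_flat j.
have coneE : cone v [:: (0, j)]%N = p j.
  rewrite cone_cons /= cone_nil mulr1; apply/eqP; rewrite -subr_eq0; apply/eqP.
  apply: (sig_inj v0 (n := j.+1)) => r d rd.
    rewrite !coefB (degp r d) // supported_tangent ?subr0 //.
    by rewrite /sumw /=; lia.
  have -> : tangent v (0, j)%N [::] = cone v [:: (0, j)]%N by rewrite cone_cons /= cone_nil mulr1.
  rewrite sigB // sigp sig_cone //=; last by rewrite /sumw /=; lia.
  rewrite mul1r; case: d rd => [|d] rd; first by rewrite flat_coef_q0 andbT subrr.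
  by rewrite flat_coef_low ?andbF ?subr0 //; lia.
have dE : (sumw [:: (0, j)%N] + 0 + 2 - size [:: (0, j)%N] - i = j.+1 - i)%N.
  by rewrite /sumw /=; lia.
rewrite /corr ifT; last by rewrite /sumw /=; lia.
rewrite coneE sigp dE; have := flat_coefP j i (j.+1 - i).
have -> : (if i is r'.+1 then flat_coef j r' (j.+1 - i) else 0) = 0.
  by case: i ij {dE} => // i ij; rewrite flat_coef_low //; lia.
rewrite addr0 => ->; rewrite flat_coef_low ?add0r; [|lia|lia].
have ij' : (i < j.+1)%N by [].
(* Only the index [i] contributes: a smaller one asks for too high a power of q, and a larger one
   falls under [flat_coef_low]. *)
rewrite (bigD1 (Ordinal ij')) //= leqnn subnn flat_coef_q0 eqxx mulr1 big1 ?addr0 // => i'.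
rewrite -val_eqE /= => ii'; have ji' := ltn_ord i'; case: leqP => // di.
by rewrite flat_coef_low ?mulr0 //; lia.
Qed.
End PrescribedInvariants.

(** * Evaluation of monomials, and splittings as subsets *)

Section MonomialEvaluation.
Variables (I : choiceType) (S : comNzRingType) (f : I -> S).

Definition cm_eval (m : cmonom I) : S := \prod_(i <- finsupp (cmonom_val m)) f i ^+ m i.

Lemma cm_evalEw (d : {fset I}) (m : cmonom I) : (finsupp m `<=` d)%fset ->
  cm_eval m = \prod_(i <- d) f i ^+ m i.
Proof.
move=> le; rewrite /cm_eval (big_fset_incl _ le) //= => i _.
by rewrite memNfinsupp => /eqP->; rewrite expr0.
Qed.

Lemma cm_eval_mmorphism : mmorphism cm_eval.
Proof.
split=> [m1 m2|]; last by rewrite /cm_eval mdom1 big_seq_fset0.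
have [le1 le2] := (fsubsetUl (finsupp m1) (finsupp m2), fsubsetUr (finsupp m1) (finsupp m2)).
rewrite (cm_evalEw le1) (cm_evalEw le2) {1}/cm_eval mdomD -big_split.
by apply: eq_bigr => i _; rewrite cmM exprD.
Qed.

HB.instance Definition _ := isMultiplicative.Build (cmonom I) S cm_eval cm_eval_mmorphism.

Lemma cm_evalU i : cm_eval (ucm i) = f i.
Proof. by rewrite /cm_eval mdomU big_seq_fset1 cmUU expr1. Qed.

End MonomialEvaluation.

Lemma subl_cons b (l : seq (nat * nat)) (S : {set 'I_(size (b :: l))}) :
  subl S = (if ord0 \in S then [:: b] else [::]) ++ @subl l (lift ord0 @^-1: S).
Proof.
have enumE n (A : {set 'I_n}) : enum A = [seq i <- enum 'I_n | i \in A].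
  by rewrite enumT.
rewrite /subl enumE enum_ordSl /=.
have -> : [seq i <- [seq lift ord0 i | i <- enum 'I_(size l)] | i \in S] =
    [seq lift ord0 i | i <- enum (lift ord0 @^-1: S)].
  rewrite filter_map (enumE _ (_ @^-1: _)); congr (map _ _).
  by apply: eq_filter => i; rewrite /= inE.
have tailE : [seq ent (b :: l) (val i) | i <- [seq lift ord0 i | i <- enum (lift ord0 @^-1: S)]] =
    [seq ent l (val i) | i <- enum (lift ord0 @^-1: S)].
  by rewrite -map_comp; apply: eq_map => i /=.
by case: ifP => _ /=; rewrite tailE.
Qed.

(** The Leibniz rule decides entry by entry which factor receives it, which amounts to choosing a
    subset. This matches [conv] with the splittings in (GW5). *)
Lemma conv_subl (R : comNzRingType) (f g : seq (nat * nat) -> R) l :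
  conv f g l = \sum_(S : {set 'I_(size l)}) f (subl S) * g (subl (~: S)).
Proof.
elim: l f g => [|b l IHl] f g /=.
  rewrite (bigD1 set0) //= [X in _ + X]big1 ?addr0 => [|S]; last first.
    by case/negP; apply/eqP/setP => -[].
  have nilE (S : {set 'I_0}) : @subl [::] S = [::].
    by rewrite /subl; case: (enum S) => // -[].
  by rewrite !nilE.
pose glue (bS : bool * {set 'I_(size l)}) : {set 'I_(size l).+1} :=
  [set i | if unlift ord0 i is Some j then j \in bS.2 else bS.1].
have glue0 bS : (ord0 \in glue bS) = bS.1 by rewrite inE unlift_none.
have glueS bS : lift ord0 @^-1: glue bS = bS.2.
  by apply/setP => i; rewrite !inE liftK.
rewrite (reindex glue) /=; last first.
  exists (fun S : {set 'I_(size l).+1} =>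
    (ord0 \in S, [set i : 'I_(size l) | lift ord0 i \in S])) => [bS _|S _].
    by rewrite glue0; case: bS => x S; congr (_, _); apply/setP => i; rewrite !inE liftK.
  by apply/setP => i; rewrite inE; case: unliftP => [j|] -> /=; rewrite ?inE.
have sublg x S : @subl (b :: l) (glue (x, S)) = (if x then [:: b] else [::]) ++ subl S.
  by rewrite subl_cons glue0 /= (glueS (x, S)).
have sublg' x S : @subl (b :: l) (~: glue (x, S)) =
    (if x then [::] else [:: b]) ++ subl (~: S).
  rewrite subl_cons inE glue0 preimsetC /= (glueS (x, S)); by case: x.
rewrite -(pair_big xpredT xpredT (fun x S =>
  f (@subl (b :: l) (glue (x, S))) * g (@subl (b :: l) (~: glue (x, S))))) /=.
rewrite big_bool /= !IHl; congr (_ + _); apply: eq_bigr => S _; by rewrite sublg sublg'.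
Qed.

Lemma natC_unit n : (0 < n)%N -> (n%:R : C) != 0.
Proof. by rewrite -[_%:R]/(n%:R : complex Rdefinitions.R) lt0n => n0; rewrite pnatr_eq0. Qed.

Lemma deg_nat l k r : deg (l, (k, r)) = (sumw l + k + 2)%:Z - (r + size l)%:Z.
Proof.
rewrite /deg /nentries /=; have -> : sumw l = (sumn [seq p.1 | p <- l] + sumn [seq p.2 | p <- l])%N.
  exact: sumwE.
by lia.
Qed.

Lemma cm_eval_mmorphE (I : choiceType) (S : comNzRingType) (U : cmonom I -> S) m :
  mmorphism U -> cm_eval (fun w : I => U (ucm w)) m = U m.
Proof.
case=> UM U1.
have UX k n : U k ^+ n = U (iter n (mmul k) mone).
  by elim: n => [|n IHn]; rewrite ?expr0 ?U1 // exprS IHn -UM.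
have iterE k n (w : I) : (iter n (mmul k) mone : cmonom I) w = (n * k w)%N.
  by elim: n => [|n IHn]; rewrite ?cm1 // iterS cmM IHn.
rewrite /cm_eval; under eq_bigr do rewrite UX.
rewrite -(big_morph U UM U1); congr U; apply/eqP/cmP => w.
rewrite (big_morph (fun k : cmonom I => k w) (cmM w) (cm1 w)).
under eq_bigr do rewrite iterE cmU.
have [wm|wm] := boolP (w \in finsupp m); last first.
  rewrite big_seq big1 => [|u um]; first by symmetry; apply/eqP; rewrite -memNfinsupp.
  by case: eqVneq um => [->|_]; rewrite ?muln0 // (negbTE wm).
rewrite (big_fsetD1 w) //= eqxx muln1 big_seq big1 ?addn0 // => u.
by rewrite !inE => /andP[/negbTE-> _]; rewrite muln0.
Qed.

Lemma malgU_mmorphism (I : choiceType) (R : comNzRingType) :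
  mmorphism (fun m : cmonom I => mkmalgU m (1 : R) : {malg R[cmonom I]}).
Proof.
by split=> [m m'|]; [rewrite malgM_def fgmulUU mulr1; reflexivity | reflexivity].
Qed.

Lemma malg_cm_evalK (I : choiceType) (R : comNzRingType) (p : {malg R[cmonom I]}) :
  \sum_(m <- msupp p) (p@_m)%:MP * cm_eval (fun w : I => mkmalgU (ucm w) (1 : R)) m = p.
Proof.
rewrite [RHS]monalgE; apply: eq_bigr => m _.
rewrite (cm_eval_mmorphE m (malgU_mmorphism I R)) malgM_def fgmulUU mulr1 mul1m.
reflexivity.
Qed.

(** * A left inverse of r *)

(** Extended by zero to all pairs. Among the pairs i <= j that occur in the differential system,
    only (0, 0) is affected. *)
Definition avar (i j : nat) : Aring :=
  if insub (i, j) is Some w then mkmalgU (ucm (w : Avar)) 1 else 0.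

Definition inv_nat (d : nat) : Aring := ((d%:R : C)^-1)%:MP.

Lemma inv_natP d : (0 < d)%N -> d%:R * inv_nat d = 1.
Proof. by move=> d0; rewrite /inv_nat -mpolyC_nat -mpolyCM mulfV ?natC_unit. Qed.

Lemma avar00 : avar 0 0 = 0.
Proof. by rewrite /avar insubF. Qed.

Definition jfun : nat -> nat -> Aring := flat_coef inv_nat avar 0.

Lemma jfun_q0 r : jfun r 0 = (r == 0%N)%:R.
Proof. exact: flat_coef0_q0. Qed.

Lemma jfun_01 : jfun 0 1 = 0.
Proof. exact: (flat_coef0_01 inv_natP avar00). Qed.

Definition sval_corr (s : sym) : Aring := corr jfun s.1 s.2.1 s.2.2.

Definition GW_to_A : CF -> Aring :=
  mmap (@malgC (cmonom Avar) C) (cm_eval (fun f : Fsym => sval_corr (val f))).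

HB.instance Definition _ := GRing.RMorphism.copy GW_to_A
  (mmap (@malgC (cmonom Avar) C) (cm_eval (fun f : Fsym => sval_corr (val f)))).

Lemma GW_to_A_sv s : GW_to_A (sv s) = sval_corr s.
Proof.
rewrite /sv; case: insubP => [f _ <-|].
  by rewrite /GW_to_A /varF mmapU cm_evalU -[RHS]mul1r; congr (_ * _); rewrite mpolyC1E.
(* For a symbol of negative degree, [sv] is 0 by convention and [corr] is 0 out of its range. *)
case: s => l [k r]; rewrite deg_nat subr_ge0 lez_nat -ltnNge => lr.
by rewrite rmorph0 /sval_corr corr_out.
Qed.

Lemma GW_to_A_C c : GW_to_A c%:MP = c%:MP.
Proof. by rewrite /GW_to_A mmapC. Qed.

Lemma GW_to_A_low k dn r l :
  GW_to_A (\sum_(j < size l)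
     (if (0 < (ent l j).1)%N
      then sv (set_nth (0%N, 0%N) l j (((ent l j).1).-1, ((ent l j).2 + k)%N), (dn, r))
      else 0)) = low_at k (fun s => corr jfun s dn r) l.
Proof.
rewrite low_at_sum rmorph_sum; apply: eq_bigr => j _ /=.
by rewrite /ent; case: ifP => _; [exact: GW_to_A_sv | exact: rmorph0].
Qed.

Lemma GW_to_A_conv (F G : seq (nat * nat) -> sym) l :
  GW_to_A (conv (fun s => sv (F s)) (fun s => sv (G s)) l) =
  conv (fun s => sval_corr (F s)) (fun s => sval_corr (G s)) l.
Proof.
apply: conv_morph => [x y|s t _]; first exact: rmorphD.
by rewrite rmorphM /= !GW_to_A_sv.
Qed.

(** * The relations hold in A *)

Lemma gen1_A l l' last : perm_eq l l' -> GW_to_A (sv (l, last) - sv (l', last)) = 0.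
Proof.
move=> ll'; rewrite rmorphB /= !GW_to_A_sv /sval_corr /=.
by rewrite (corr_perm jfun_q0 jfun_01 _ _ ll') subrr.
Qed.

Lemma eq_div_malgC (x : Aring) (m n : nat) : (0 < n)%N ->
  x * n%:R = m%:R -> x = (m%:R / n%:R : C)%:MP.
Proof.
move=> n0 xE; rewrite mpolyCM mpolyC_nat -/(inv_nat n) -xE -mulrA inv_natP //.
by rewrite mulr1.
Qed.

Lemma gen2_A s : deg s = 0 -> GW_to_A (sv s - (gw2_value s)%:MP) = 0.
Proof.
case: s => l [k r]; rewrite deg_nat => /eqP; rewrite subr_eq0 eqz_nat => /eqP lr.
rewrite rmorphB /= GW_to_A_sv GW_to_A_C /sval_corr /gw2_value /dlist /nentries /=.
have sumE : sumn ([seq p.1 | p <- l] ++ [:: k]) = (sumpsi l + k)%N.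
  by rewrite sumn_cat /= addn0.
rewrite sumE; case: eqP => lk; last first.
  by rewrite (corr_deg0 jfun_q0 jfun_01) ?malgC0E ?subrr //; lia.
have lk' : size l = (sumpsi l + k + 2)%N by lia.
have -> : \prod_(d <- [seq p.1 | p <- l] ++ [:: k]) d`! = (psi_fact l * k`!)%N.
  by rewrite big_cat big_seq1 big_map.
have D0 : (0 < psi_fact l * k`!)%N.
  by rewrite muln_gt0 fact_gt0 prodn_gt0 // => b; exact: fact_gt0.
by rewrite (eq_div_malgC D0 (corr_multinomial jfun_q0 jfun_01 (esym lr) lk')) subrr.
Qed.

Lemma gen3_A l dn r : 0 <= deg ((0%N, 0%N) :: l, (dn, r)) ->
  ~ (exists i, l = [:: (0%N, i)] /\ (dn, r) = (0%N, i)) ->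
  GW_to_A (sv ((0%N, 0%N) :: l, (dn, r)) - gw3_rhs l dn r) = 0.
Proof.
rewrite deg_nat subr_ge0 lez_nat sumw_cons /= => lr nex.
rewrite rmorphB /= GW_to_A_sv /sval_corr (corr_string jfun_q0 jfun_01) //=; last by lia.
apply/eqP; rewrite subr_eq0; apply/eqP; rewrite /gw3_rhs rmorphD /=; congr (_ + _).
  by rewrite -GW_to_A_low; congr GW_to_A; apply: eq_bigr => j _; rewrite addn0.
by case: ifP; rewrite ?rmorph0 // GW_to_A_sv.
Qed.

Lemma gen4_A l dn r : 0 < deg ((0%N, 1%N) :: l, (dn, r)) ->
  GW_to_A (sv ((0%N, 1%N) :: l, (dn, r))
           - gw4_rhs (deg ((0%N, 1%N) :: l, (dn, r))) l dn r) = 0.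
Proof.
rewrite deg_nat subr_gt0 ltz_nat sumw_cons /= => lr.
have t1 : GW_to_A (((0 + 1 + sumw l + dn + 2)%:Z - (r + (size l).+1)%:Z)%:~R * sv (l, (dn, r)))
    = (sumw l + dn + 2 - size l - r)%:R * corr jfun l dn r.
  rewrite rmorphM /= GW_to_A_sv rmorph_int pmulrn; congr (_%:~R * _); lia.
have t2 : GW_to_A (\sum_(j < size l)
     (if (0 < (ent l j).1)%N
      then sv (set_nth (0%N, 0%N) l j (((ent l j).1).-1, ((ent l j).2).+1), (dn, r))
      else 0)) = low_at 1 (fun s => corr jfun s dn r) l.
  by rewrite -GW_to_A_low; congr GW_to_A; apply: eq_bigr => j _; rewrite addn1.
have t3 : GW_to_A (if (0 < dn)%N && (0 < r)%N then sv (l, (dn.-1, r.-1)) else 0)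
    = if (0 < dn)%N && (0 < r)%N then corr jfun l dn.-1 r.-1 else 0.
  by case: ifP => _; [exact: GW_to_A_sv | exact: rmorph0].
rewrite rmorphB /= GW_to_A_sv /sval_corr (corr_divisor jfun_q0 jfun_01) //=; last by lia.
by rewrite /gw4_rhs 2!rmorphD /= t3 t2 t1 subrr.
Qed.

Lemma sum_iota_ord (V : nmodType) N (F : nat -> V) :
  \sum_(a <- iota 0 N) F a = \sum_(a < N) F a.
Proof. by rewrite -(big_mkord xpredT) /index_iota subn0. Qed.

Lemma gw5_rhs1E ll d1 j1 d2 j2 d3 r : gw5_rhs1 ll d1 j1 d2 j2 d3 r =
  \sum_(a < (gw5_bound ll d1 j1 d2 j2).+1)
    conv (fun s => sv ((d1.-1, j1) :: s, (0%N, val a)))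
         (fun s => sv ((0%N, val a) :: s ++ [:: (d2, j2)], (d3, r))) ll.
Proof.
rewrite /gw5_rhs1 exchange_big sum_iota_ord; apply: eq_bigr => a _.
by rewrite conv_subl.
Qed.

Lemma gw5_rhs2E ll d1 j1 d2 j2 d3 r : gw5_rhs2 ll d1 j1 d2 j2 d3 r =
  \sum_(a < (gw5_bound ll d1 j1 d2 j2).+1)
    conv (fun s => sv (s ++ [:: (d1, j1); (d2, j2)], (0%N, val a)))
         (fun s => sv ((0%N, val a) :: s, (d3.-1, r))) ll.
Proof.
rewrite /gw5_rhs2 exchange_big sum_iota_ord; apply: eq_bigr => a _.
by rewrite conv_subl.
Qed.

Lemma gen5a_A ll d1 j1 d2 j2 d3 r :
  0 <= deg (ll ++ [:: (d1, j1); (d2, j2)], (d3, r)) -> (1 <= d1)%N ->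
  GW_to_A (sv (ll ++ [:: (d1, j1); (d2, j2)], (d3, r)) - gw5_rhs1 ll d1 j1 d2 j2 d3 r) = 0.
Proof.
case: d1 => // n; rewrite deg_nat subr_ge0 lez_nat => lr _.
rewrite rmorphB /= GW_to_A_sv /sval_corr /=.
have pl : perm_eq (ll ++ [:: (n.+1, j1); (d2, j2)]) [:: (n.+1, j1), (d2, j2) & ll].
  by rewrite perm_catC.
rewrite (corr_perm jfun_q0 jfun_01 _ _ pl).
rewrite (corr_trr_first jfun_q0 jfun_01 (N := (gw5_bound ll n.+1 j1 d2 j2).+1)); first last.
- by rewrite -(sumw_perm pl) -(size_perm pl).
- by rewrite !sumw_cons /gw5_bound -/(sumw ll) /=; lia.
apply/eqP; rewrite subr_eq0; apply/eqP; rewrite gw5_rhs1E rmorph_sum.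
apply: eq_bigr => a _ /=; rewrite (GW_to_A_conv (fun s => ((n, j1) :: s, (0%N, val a)))
  (fun s => ((0%N, val a) :: s ++ [:: (d2, j2)], (d3, r)))) /sval_corr /=.
apply: eq_conv => // s _; apply: (corr_perm jfun_q0 jfun_01).
by rewrite perm_cons perm_sym perm_catC.
Qed.

Lemma gen5b_A ll d1 j1 d2 j2 d3 r :
  0 <= deg (ll ++ [:: (d1, j1); (d2, j2)], (d3, r)) -> (1 <= d3)%N ->
  GW_to_A (sv (ll ++ [:: (d1, j1); (d2, j2)], (d3, r)) - gw5_rhs2 ll d1 j1 d2 j2 d3 r) = 0.
Proof.
case: d3 => // k; rewrite deg_nat subr_ge0 lez_nat => lr _.
rewrite rmorphB /= GW_to_A_sv /sval_corr /=.
have pl (s : seq (nat * nat)) : perm_eq (s ++ [:: (d1, j1); (d2, j2)]) [:: (d1, j1), (d2, j2) & s].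
  by rewrite perm_catC.
rewrite (corr_perm jfun_q0 jfun_01 _ _ (pl ll)).
rewrite (corr_trr_last jfun_q0 jfun_01 (N := (gw5_bound ll d1 j1 d2 j2).+1)); first last.
- by rewrite -(sumw_perm (pl ll)) -(size_perm (pl ll)).
- by rewrite !sumw_cons /gw5_bound -/(sumw ll) /=; lia.
apply/eqP; rewrite subr_eq0; apply/eqP; rewrite gw5_rhs2E rmorph_sum.
apply: eq_bigr => a _ /=; rewrite (GW_to_A_conv
  (fun s => (s ++ [:: (d1, j1); (d2, j2)], (0%N, val a)))
  (fun s => ((0%N, val a) :: s, (k, r)))) /sval_corr /=.
apply: eq_conv => // s _; apply/esym/(corr_perm jfun_q0 jfun_01)/pl.
Qed.

Lemma GW_to_A_gen g : gen g -> GW_to_A g = 0.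
Proof.
case=> [l l' last _|s|l dn r|l dn r|ll d1 j1 d2 j2 d3 r|ll d1 j1 d2 j2 d3 r].
- exact: gen1_A.
- exact: gen2_A.
- exact: gen3_A.
- exact: gen4_A.
- exact: gen5a_A.
- exact: gen5b_A.
Qed.

Lemma GW_to_A_Rel p : Rel p -> GW_to_A p = 0.
Proof.
case=> k [c [g [gg ->]]]; rewrite rmorph_sum big1 // => j _.
by rewrite rmorphM /= (GW_to_A_gen (gg j)) mulr0.
Qed.

Lemma rhoE : rho =1 mmap (@malgC (cmonom Fsym) C) (cm_eval (fun w : Avar => sv (a_sym w))).
Proof. by []. Qed.

Lemma GW_to_A_a_sym (w : Avar) : GW_to_A (sv (a_sym w)) = mkmalgU (ucm w) 1.
Proof.
have : ((val w).1 <= (val w).2)%N && (0 < (val w).2)%N := valP w.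
move=> /andP[le_ij _]; rewrite GW_to_A_sv.
have -> : sval_corr (a_sym w) = avar (val w).1 (val w).2.
  exact: (corr_prescribed inv_natP avar00 le_ij).
rewrite /avar -surjective_pairing; case: insubP => [w' _ /val_inj -> //|].
by rewrite (valP w).
Qed.

(** On the variables this is [corr_prescribed]. Since [GW_to_A] kills the relations, it makes r
    injective. *)
Lemma rhoK p : GW_to_A (rho p) = p.
Proof.
rewrite -[RHS]malg_cm_evalK rmorph_sum; apply: eq_bigr => m _.
rewrite rmorphM /= GW_to_A_C rmorph_prod; congr (_ * _); apply: eq_bigr => w _.
by rewrite rmorphXn /= GW_to_A_a_sym.
Qed.

(** * Reconstruction *)

Lemma Rel0 : Rel 0.
Proof.
exists 0%N, (fun=> 0), (fun=> 0); split; first by case.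
by rewrite big_ord0.
Qed.

Lemma lincombD (R : comNzRingType) (G : R -> Prop) (k k' : nat)
    (c g : 'I_k -> R) (c' g' : 'I_k' -> R) :
  (forall j, G (g j)) -> (forall j, G (g' j)) ->
  exists (n : nat) (d h : 'I_n -> R), (forall j, G (h j)) /\
    \sum_(j < k) c j * g j + \sum_(j < k') c' j * g' j = \sum_(j < n) d j * h j.
Proof.
move=> gP gP'; pose glue (f : 'I_k -> R) (f' : 'I_k' -> R) (j : 'I_(k + k')) :=
  match split j with inl i => f i | inr i => f' i end.
have glueL f f' i : glue f f' (lshift k' i) = f i.
  by rewrite /glue (unsplitK (inl i : 'I_k + 'I_k')).
have glueR f f' i : glue f f' (rshift k i) = f' i.
  by rewrite /glue (unsplitK (inr i : 'I_k + 'I_k')).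
exists (k + k')%N, (glue c c'), (glue g g'); split.
  by move=> j; rewrite /glue; case: (split j).
by rewrite big_split_ord; congr (_ + _); apply: eq_bigr => i _; rewrite ?glueL ?glueR.
Qed.

Lemma RelD p q : Rel p -> Rel q -> Rel (p + q).
Proof.
by move=> [k [c [g [gP ->]]]] [k' [c' [g' [gP' ->]]]]; exact: lincombD.
Qed.

Lemma RelM x p : Rel p -> Rel (x * p).
Proof.
move=> [k [c [g [gP ->]]]]; exists k, (fun j => x * c j), g; split=> //.
by rewrite mulr_sumr; apply: eq_bigr => j _; rewrite mulrA.
Qed.

Lemma RelN p : Rel p -> Rel (- p).
Proof. by rewrite -mulN1r; exact: RelM. Qed.

Lemma RelB p q : Rel p -> Rel q -> Rel (p - q).
Proof. by move=> rp rq; apply: RelD => //; apply: RelN. Qed.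

Lemma Rel_gen g : gen g -> Rel g.
Proof.
move=> gg; exists 1%N, (fun=> 1), (fun=> g); split=> //.
by rewrite big_ord1 mul1r.
Qed.

Lemma Rel_sum (I : Type) (s : seq I) (F : I -> CF) :
  (forall i, Rel (F i)) -> Rel (\sum_(i <- s) F i).
Proof. by move=> FR; elim/big_ind: _ => // [|x y]; [exact: Rel0 | exact: RelD]. Qed.

HB.instance Definition _ := GRing.RMorphism.copy rho
  (mmap (@malgC (cmonom Fsym) C) (cm_eval (fun w : Avar => sv (a_sym w)))).

Lemma rhoD p q : rho (p + q) = rho p + rho q.
Proof. exact: rmorphD. Qed.

Lemma rhoM p q : rho (p * q) = rho p * rho q.
Proof. exact: rmorphM. Qed.

Lemma rhoC c : rho c%:MP = c%:MP.
Proof. by rewrite rhoE mmapC. Qed.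

(** The class of [x] in GW lies in the image of r. *)
Definition generated (x : CF) := exists p : Aring, Rel (x - rho p).

Lemma generatedD x y : generated x -> generated y -> generated (x + y).
Proof.
move=> [p xp] [q yq]; exists (p + q); rewrite rhoD opprD addrACA. exact: (RelD xp yq).
Qed.

Lemma mulrB_split (R : comNzRingType) (x y a b : R) :
  x * y - a * b = y * (x - a) + a * (y - b).
Proof. by ring. Qed.

Lemma generatedM x y : generated x -> generated y -> generated (x * y).
Proof.
move=> [p xp] [q yq]; exists (p * q); rewrite rhoM.
rewrite mulrB_split.
exact: (RelD (RelM y xp) (RelM (rho p) yq)).
Qed.

Lemma generatedC c : generated c%:MP.
Proof.
by exists c%:MP; rewrite rhoC subrr; exact: Rel0.
Qed.

Lemma generated_eq x y : Rel (x - y) -> generated y -> generated x.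
Proof.
move=> xy [p yp]; exists p; rewrite -(subrKA y).
exact: (RelD xy yp).
Qed.

Lemma generated_Rel x : Rel x -> generated x.
Proof.
by move=> xR; apply: (@generated_eq _ 0%:MP); [rewrite malgC0E subr0 | exact: generatedC].
Qed.

Lemma generated0 : generated 0. Proof. exact/generated_Rel/Rel0. Qed.

Lemma generatedB x y : generated x -> generated y -> generated (x - y).
Proof.
move=> xG yG; apply: generatedD => //; rewrite -mulN1r; apply: generatedM => //.
by rewrite -mpolyC1E -monalgUN; exact: generatedC.
Qed.

Lemma generated_sum (I : Type) (s : seq I) (Q : pred I) (F : I -> CF) :
  (forall i, Q i -> generated (F i)) -> generated (\sum_(i <- s | Q i) F i).
Proof. by move=> FG; elim/big_ind: _ => //; [exact: generated0 | exact: generatedD]. Qed.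

Lemma sv_neg s : deg s < 0 -> sv s = 0.
Proof. by rewrite /sv; case: insubP => // f f0 _ fneg; have : 0 <= deg s := f0; lia. Qed.

Lemma Rel_perm l l' last : perm_eq l l' -> Rel (sv (l, last) - sv (l', last)).
Proof.
case: last => k r ll'; have [d0|dneg] : 0 <= deg (l, (k, r)) \/ deg (l, (k, r)) < 0 by lia.
  exact/Rel_gen/gen1.
have degE : deg (l', (k, r)) = deg (l, (k, r)).
  by rewrite !deg_nat (sumw_perm ll') (size_perm ll').
by rewrite !sv_neg ?degE // subrr; exact: Rel0.
Qed.

Lemma generated_perm l l' last : perm_eq l l' ->
  generated (sv (l', last)) -> generated (sv (l, last)).
Proof. by move=> ll'; apply: generated_eq; exact: Rel_perm. Qed.

Lemma generated_deg0 s : deg s = 0 -> generated (sv s).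
Proof. by move=> d0; apply: (generated_eq (Rel_gen (gen2 d0))); exact: generatedC. Qed.

Lemma generated_a (w : Avar) : generated (sv (a_sym w)).
Proof.
exists (mkmalgU (ucm w) 1); rewrite rhoE mmapU cm_evalU -[X in X - _]mul1r.
rewrite -mulrBl (_ : 1 - _ = 0) ?mul0r; first exact: Rel0.
by apply/eqP; rewrite subr_eq0 eq_sym; apply/eqP; exact: mpolyC1E.
Qed.

(** For n = 2 the condition for M = 1 asks for -1 psi classes. *)
Lemma Rel_two_point_deg0 b last : deg ([:: b], last) = 0 -> Rel (sv ([:: b], last)).
Proof.
move=> d0; have := Rel_gen (gen2 d0); rewrite /gw2_value /nentries /dlist /=.
by rewrite malgC0E subr0.
Qed.

Lemma generated_natM n x : generated x -> generated (n%:R * x).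
Proof. by apply: generatedM; rewrite -mpolyC_nat; exact: generatedC. Qed.

Lemma generated_natMV n x : (0 < n)%N -> generated (n%:R * x) -> generated x.
Proof.
move=> n0; have nV : ((n%:R : C)^-1)%:MP * n%:R = 1 :> CF.
  by rewrite -mpolyC_nat -mpolyCM mulVf ?natC_unit.
move=> nxG; have := generatedM (generatedC (n%:R : C)^-1) nxG.
by rewrite mulrA nV mul1r.
Qed.

Lemma generated_addl x y z : Rel (x - (y + z)) -> generated z -> generated x -> generated y.
Proof.
move=> rel zG xG; rewrite -(addrK z y); apply: generatedB zG; apply: generated_eq xG.
by rewrite -opprB; exact: RelN.
Qed.

Lemma gw2_value_three_point i j r : gw2_value ([:: (0, i); (0, j)]%N, (0, r)%N) = 1.
Proof.
rewrite /gw2_value /nentries /dlist /=.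
rewrite !big_cons big_nil.
by rewrite divff ?oner_neq0.
Qed.

Lemma generated_mulV u x : Rel (u - 1%:MP) -> generated (u * x) -> generated x.
Proof.
move=> u1; apply: generated_eq; have -> : x - u * x = - x * (u - 1%:MP).
  by rewrite mpolyC1E mulrBr mulr1 mulNr opprK addrC [x * u]mulrC.
exact: RelM.
Qed.

Lemma cancel_identity (R : comNzRingType) (a1 a2 t1 x1 x2 t2 : R) :
  a1 - a2 = x1 - x2 - (x1 - (a1 + t1)) + (x2 - (a2 + t2)) - (t1 - t2).
Proof. by ring. Qed.

Lemma Rel_cancel x1 x2 a1 a2 t1 t2 : Rel (x1 - x2) ->
  Rel (x1 - (a1 + t1)) -> Rel (x2 - (a2 + t2)) -> Rel (t1 - t2) -> Rel (a1 - a2).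
Proof.
move=> R12 R1 R2 Rt; rewrite (cancel_identity a1 a2 t1 x1 x2 t2).
exact: (RelB (RelD (RelB R12 R1) R2) Rt).
Qed.

(** * Symbols of a fixed positive degree D *)

Section Reconstruction.
Variable D : nat.
Hypothesis D0 : (0 < D)%N.
Hypothesis low_degree : forall s, deg s < D%:Z -> generated (sv s).

(** Unless a factor is zero, both degrees are below D, or one is D and the other 0. In the latter
    case the product lies in [Rel] if the factor of degree 0 is a two-point symbol; otherwise the
    factor of degree D has to be generated. *)
Lemma generated_mul s1 s2 : deg s1 + deg s2 = D%:Z ->
  size s2.1 = 1%N \/ (deg s1 = D%:Z -> generated (sv s1)) ->
  size s1.1 = 1%N \/ (deg s2 = D%:Z -> generated (sv s2)) ->
  generated (sv s1 * sv s2).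
Proof.
move=> dD c1 c2.
have [d1neg|d1] : deg s1 < 0 \/ 0 <= deg s1 by lia.
  by rewrite sv_neg // mul0r; exact: generated0.
have [d2neg|d2] : deg s2 < 0 \/ 0 <= deg s2 by lia.
  by rewrite (sv_neg d2neg) mulr0; exact: generated0.
have Rel_two_point s : size s.1 = 1%N -> deg s = 0 -> Rel (sv s).
  by case: s => -[|b [|]] // last _; exact: Rel_two_point_deg0.
have [d1D|d1D] := eqVneq (deg s1) D%:Z.
  have d20 : deg s2 = 0 by lia.
  case: c1 => [sz2|g1]; first by apply: generated_Rel; apply: RelM; exact: Rel_two_point.
  by apply: generatedM; [exact: g1 | exact: generated_deg0].
have [d2D|d2D] := eqVneq (deg s2) D%:Z.
  have d10 : deg s1 = 0 by lia.
  case: c2 => [sz1|g2].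
    by apply: generated_Rel; rewrite mulrC; apply: RelM; exact: Rel_two_point.
  by apply: generatedM; [exact: generated_deg0 | exact: g2].
by apply: generatedM; apply: low_degree; lia.
Qed.

Lemma generated_conv (f g : seq (nat * nat) -> CF) l :
  (forall s t : seq (nat * nat), perm_eq (s ++ t) l -> generated (f s * g t)) ->
  generated (conv f g l).
Proof. by move=> fg; apply: conv_ind => // x y; exact: generatedD. Qed.

(** The second factor keeps all entries only if the first is a two-point symbol, which is zero in
    degree 0. So the factors of degree D that matter have fewer entries than the symbol itself. *)
Lemma generated_trr_first n j b l k r :
  deg ([:: (n.+1, j), b & l], (k, r)) = D%:Z ->
  (forall s a, (size s <= size l)%N -> deg ((n, j) :: s, (0%N, a)) = D%:Z ->
     generated (sv ((n, j) :: s, (0%N, a)))) ->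
  (forall t a, (size t < size l)%N -> deg ([:: (0%N, a), b & t], (k, r)) = D%:Z ->
     generated (sv ([:: (0%N, a), b & t], (k, r)))) ->
  generated (sv ([:: (n.+1, j), b & l], (k, r))).
Proof.
case: b => d2 j2 dD gen1 gen2.
have pl (s : seq (nat * nat)) : perm_eq [:: (n.+1, j), (d2, j2) & s]
    (s ++ [:: (n.+1, j); (d2, j2)]) by rewrite perm_sym perm_catC.
apply: (generated_perm (pl l)).
have dD' : deg (l ++ [:: (n.+1, j); (d2, j2)], (k, r)) = D%:Z.
  by move: dD; rewrite !deg_nat (sumw_perm (pl l)) (size_perm (pl l)).
apply: (generated_eq (Rel_gen (gen5a _ _))); rewrite ?dD' //.
rewrite gw5_rhs1E; apply: generated_sum => a _; apply: generated_conv => s t st.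
have szl := split_size st; have swl := split_sumw st.
have pt : perm_eq ((0%N, val a) :: t ++ [:: (d2, j2)]) [:: (0%N, val a), (d2, j2) & t].
  by rewrite perm_cons perm_catC.
apply: generated_mul => /=.
- move: dD; rewrite !deg_nat (sumw_perm pt) (size_perm pt) !sumw_cons /= swl szl; lia.
- by right; apply: gen1; rewrite szl leq_addr.
case: s st szl swl => [|c s] st szl swl; first by left.
right => dt; apply: (generated_perm pt); apply: gen2; first by rewrite szl /=; lia.
by move: dt; rewrite !deg_nat (sumw_perm pt) (size_perm pt).
Qed.

(** Here the first factor keeps all entries only if the second is a two-point symbol. *)
Lemma generated_trr_last b c l k r :
  deg ([:: b, c & l], (k.+1, r)) = D%:Z ->
  (forall s a, (size s < size l)%N -> deg ([:: b, c & s], (0%N, a)) = D%:Z ->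
     generated (sv ([:: b, c & s], (0%N, a)))) ->
  (forall t a, (size t <= size l)%N -> deg ((0%N, a) :: t, (k, r)) = D%:Z ->
     generated (sv ((0%N, a) :: t, (k, r)))) ->
  generated (sv ([:: b, c & l], (k.+1, r))).
Proof.
case: b c => d1 j1 [d2 j2] dD gen1 gen2.
have pl (s : seq (nat * nat)) : perm_eq [:: (d1, j1), (d2, j2) & s]
    (s ++ [:: (d1, j1); (d2, j2)]) by rewrite perm_sym perm_catC.
apply: (generated_perm (pl l)).
have dD' : deg (l ++ [:: (d1, j1); (d2, j2)], (k.+1, r)) = D%:Z.
  by move: dD; rewrite !deg_nat (sumw_perm (pl l)) (size_perm (pl l)).
apply: (generated_eq (Rel_gen (gen5b _ _))); rewrite ?dD' //.
rewrite gw5_rhs2E; apply: generated_sum => a _; apply: generated_conv => s t st.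
have szl := split_size st; have swl := split_sumw st.
apply: generated_mul => /=.
- move: dD; rewrite !deg_nat -(sumw_perm (pl s)) -(size_perm (pl s)) !sumw_cons /= swl szl; lia.
- case: t st szl swl => [|x t] st szl swl; first by left.
  right => ds; have pl' := pl s; rewrite perm_sym in pl'; apply: (generated_perm pl').
  apply: gen1; first by rewrite szl /=; lia.
  by move: ds; rewrite !deg_nat (sumw_perm pl') (size_perm pl').
by right; apply: gen2; rewrite szl leq_addl.
Qed.

Lemma low_sum_generated l last :
  (forall b s, perm_eq (b :: s) l -> (0 < b.1)%N -> generated (sv ((b.1.-1, b.2.+1) :: s, last))) ->
  generated (\sum_(j < size l)
     (if (0 < (ent l j).1)%N
      then sv (set_nth (0%N, 0%N) l j (((ent l j).1).-1, ((ent l j).2).+1), last)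
      else 0)).
Proof.
move=> lG; apply: generated_sum => j _; case: ifP => [b0|_]; last exact: generated0.
have jl := ltn_ord j.
have pj x : perm_eq (set_nth (0%N, 0%N) l j x) (x :: (take j l ++ drop j.+1 l)).
  by rewrite set_nthE jl perm_sym (perm_catCA [:: x]).
apply: (generated_perm (pj _)); apply: (lG (ent l j)) => //.
by rewrite -(perm_catCA (take j l) [:: _]) /= -drop_nth // cat_take_drop.
Qed.

(** An extra entry H^1 preserves the degree D, and (GW4) multiplies the original symbol by D, which
    is invertible; the other terms have one psi class less. *)
Lemma divisor_generated l k r : deg (l, (k, r)) = D%:Z ->
  (forall b s, perm_eq (b :: s) l -> (0 < b.1)%N ->
     generated (sv ((b.1.-1, b.2.+1) :: s, (k, r)))) ->
  ((0 < k)%N -> (0 < r)%N -> generated (sv (l, (k.-1, r.-1)))) ->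
  (generated (sv (l, (k, r))) <-> generated (sv ((0%N, 1%N) :: l, (k, r)))).
Proof.
move=> dD lowG lastG.
have dD1 : deg ((0%N, 1%N) :: l, (k, r)) = D%:Z.
  by move: dD; rewrite !deg_nat sumw_cons /=; lia.
have g4 : gen (sv ((0%N, 1%N) :: l, (k, r)) - gw4_rhs D l k r).
  by rewrite -dD1; apply: gen4; rewrite dD1.
have lowS : generated (\sum_(j < size l)
     (if (0 < (ent l j).1)%N
      then sv (set_nth (0%N, 0%N) l j (((ent l j).1).-1, ((ent l j).2).+1), (k, r))
      else 0)).
  exact: low_sum_generated.
have lastS : generated (if (0 < k)%N && (0 < r)%N then sv (l, (k.-1, r.-1)) else 0).
  by case: ifP => [/andP[k0 r0]|_]; [exact: lastG | exact: generated0].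
have restS := generatedD lowS lastS.
move: (Rel_gen g4); rewrite /gw4_rhs -addrA -pmulrn => rel; split=> G.
  by apply: (generated_eq rel); apply: generatedD => //; exact: generated_natM.
by apply: (generated_natMV D0); exact: (generated_addl rel restS G).
Qed.

(** Induction on the number of psi classes. After an entry H^1 is added, topological recursion leads
    to two-point symbols with fewer psi classes; without psi classes the symbol is <H^1, H^i,
    H_r>. *)
Lemma two_point_generated a i b r :
  deg ([:: (a, i)], (b, r)) = D%:Z -> generated (sv ([:: (a, i)], (b, r))).
Proof.
have [m] := ubnP (a + b); elim: m a i b r => // m IHm a i b r; rewrite ltnS => abm dD.
apply/(divisor_generated dD).
- move=> c s /perm_small_eq-/(_ isT)[-> ->] /= a0; apply: IHm; first by lia.
  by move: dD; rewrite !deg_nat /sumw /=; lia.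
- by move=> b0 r0; apply: IHm; [lia | move: dD; rewrite !deg_nat /sumw /=; lia].
case: a abm dD => [|n] abm dD; last first.
  apply: (generated_perm (l' := [:: (n.+1, i); (0, 1)%N])).
    exact: (permEl (perm_catC [:: (0, 1)%N] [:: (n.+1, i)])).
  apply: generated_trr_first => //; first by move: dD; rewrite !deg_nat /sumw /=; lia.
  by move=> [|//] c _ dc; apply: IHm => //; lia.
case: b abm dD => [|k] abm dD; last first.
  apply: generated_trr_last => //; first by move: dD; rewrite !deg_nat /sumw /=; lia.
  by move=> [|//] c _ dc; apply: IHm => //; lia.
have ri : (r <= i)%N by move: dD; rewrite !deg_nat /sumw /=; lia.
(* The symbol <H^1, H^0, H_0> is not the image of a variable; the string equation makes it 0. *)
case: i ri dD {abm} => [|i] ri dD.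
  move: ri; rewrite leqn0 => /eqP r0.
  apply: (generated_perm (l' := [:: (0, 0)%N; (0, 1)%N])).
    exact: (permEl (perm_catC [:: (0, 1)%N] [:: (0, 0)%N])).
  apply: (@generated_eq _ (gw3_rhs [:: (0, 1)%N] 0 r)).
    apply/Rel_gen/gen3; first by rewrite deg_nat r0 /sumw /=.
    by case=> i [[<-] []]; rewrite r0.
  rewrite /gw3_rhs big_ord1 /= addr0; exact: generated0.
have w : (r <= i.+1)%N && (0 < i.+1)%N by rewrite ri.
exact: (generated_a (exist _ (r, i.+1) w)).
Qed.

(** Adding H^1 gives a two-point symbol, and the last term of (GW4) is a one-point symbol with
    smaller [r]. *)
Lemma one_point_generated k r : deg ([::], (k, r)) = D%:Z -> generated (sv ([::], (k, r))).
Proof.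
elim: r k => [|r IHr] k dD; apply/(divisor_generated dD) => //.
- by move=> b s /perm_size.
- by apply: two_point_generated; move: dD; rewrite !deg_nat /sumw /=; lia.
- by move=> b s /perm_size.
- by move=> k0 _; apply: IHr; move: dD; rewrite !deg_nat /sumw /=; lia.
by apply: two_point_generated; move: dD; rewrite !deg_nat /sumw /=; lia.
Qed.

(** * Symbols without psi classes *)

Section PrimarySymbols.
Variable N : nat.
Hypothesis fewer_points : forall s, deg s = D%:Z -> (size s.1 < N)%N -> generated (sv s).

(* WDVV: expand <Y, Z, l, tau_1 H^1, H_r> by the first relation of (GW5) in two
   ways and cancel the common terms. *)
Lemma Rel_wdvv i j l r (B := (gw5_bound ((0%N, j) :: l) 1 1 0 i).+1)
    (F := fun i a s => sv ([:: (0%N, 1%N), (0%N, i) & s], (0%N, a)))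
    (G := fun i a s => sv ((0%N, a) :: s ++ [:: (0%N, i)], (0%N, r))) :
  deg ([:: (0%N, i.+1), (0%N, j) & l], (0%N, r)) = D%:Z ->
  Rel (\sum_(a < B) conv (F j a) (G i a) l - \sum_(a < B) conv (F i a) (G j a) l).
Proof.
move=> dD.
(* The Leibniz rule at the entry H^j' separates the terms where it joins the first factor from those
   where it joins the second. The latter agree in the two expansions up to the order of the
   entries. *)
have rel (i' j' : nat) : (i + j = i' + j')%N ->
    Rel (sv (((0, j') :: l) ++ [:: (1, 1); (0, i')], (0, r))%N -
         (\sum_(a < B) conv (F j' a) (G i' a) l +
          \sum_(a < B) conv (fun s => sv ((0%N, 1%N) :: s, (0%N, val a)))
                            (fun s => G i' a ((0%N, j') :: s)) l)).
  move=> ij; have pl : perm_eq (((0, j') :: l) ++ [:: (1, 1); (0, i')])%N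
      [:: (1, 1), (0, i'), (0, j') & l]%N by rewrite perm_catC.
  have := Rel_gen (@gen5a ((0%N, j') :: l) 1 1 0 i' 0 r _ isT); rewrite gw5_rhs1E -big_split.
  have -> : gw5_bound ((0%N, j') :: l) 1 1 0 i' = gw5_bound ((0%N, j) :: l) 1 1 0 i.
    by rewrite /gw5_bound /=; lia.
  apply; rewrite deg_nat (sumw_perm pl) (size_perm pl).
  by move: dD; rewrite deg_nat !sumw_cons /=; lia.
have R1 := rel i j (erefl _); have R2 := rel j i (addnC i j).
have pij : perm_eq (((0, j) :: l) ++ [:: (1, 1); (0, i)])%N
    (((0, i) :: l) ++ [:: (1, 1); (0, j)])%N.
  by apply/permP => f; rewrite /= !count_cat /=; lia.
have R12 := Rel_perm (0%N, r) pij.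
have Rtail : Rel (\sum_(a < B) conv (fun s => sv ((0%N, 1%N) :: s, (0%N, val a)))
                            (fun s => G i a ((0%N, j) :: s)) l -
                  \sum_(a < B) conv (fun s => sv ((0%N, 1%N) :: s, (0%N, val a)))
                            (fun s => G j a ((0%N, i) :: s)) l).
  rewrite -sumrB; apply: Rel_sum => a; rewrite -convBr.
  apply: conv_ind => [x y|s t _]; [exact: RelD | apply: RelM; apply: Rel_perm].
  by apply/permP => f; rewrite /= !count_cat /=; lia.
exact: (Rel_cancel R12 R1 R2 Rtail).
Qed.

(** Induction on the exponent. To reach H^(i+1), the term of [Rel_wdvv] with nothing split off and a
    = i + 1 is <H^1, H^i, H_(i+1)> = 1 times the symbol sought. The other factors of degree D
    contain H^1, contain H^i, or have fewer entries. *)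
Lemma primary_generated i l r : (size l).+1 = N -> (0 < size l)%N ->
  all (fun b : nat * nat => b.1 == 0%N) l ->
  deg ((0%N, i) :: l, (0%N, r)) = D%:Z -> generated (sv ((0%N, i) :: l, (0%N, r))).
Proof.
have noLow (s : seq (nat * nat)) : all (fun b : nat * nat => b.1 == 0%N) s ->
    forall j, (0 < (ent s j).1)%N = false.
  move=> s0 j; rewrite /ent; have [js|js] := ltnP j (size s); last by rewrite nth_default.
  by rewrite (eqP (all_nthP (0%N, 0%N) s0 j js)).
have H1 s r' : (size s < N)%N -> all (fun b : nat * nat => b.1 == 0%N) s ->
    deg ((0%N, 1%N) :: s, (0%N, r')) = D%:Z -> generated (sv ((0%N, 1%N) :: s, (0%N, r'))).
  move=> sN s0 dD.
  have dD' : deg (s, (0%N, r')) = D%:Z by move: dD; rewrite !deg_nat sumw_cons /=; lia.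
  apply/(divisor_generated dD') => // [b t bt|].
    by move/allP/(_ b): s0; rewrite -(perm_mem bt) mem_head => /(_ isT)/eqP->.
  exact: fewer_points.
elim: i l r => [|i IHi] l r lN l0 l00 dD.
  apply: (@generated_eq _ (gw3_rhs l 0 r)).
    apply/Rel_gen/gen3; first by rewrite dD.
    move=> [i' [lE [rE]]]; move: dD; rewrite lE -rE deg_nat /sumw /=; lia.
  rewrite /gw3_rhs /= addr0; apply: generated_sum => j _; rewrite noLow //.
  exact: generated0.
have [i0|i0] := posnP i; first by move: dD; rewrite i0 => dD; apply: H1 => //; rewrite -lN.
case: l lN l0 l00 dD => // -[d0 j] l lN _ /andP[/eqP d00 l00] dD.
rewrite /= in d00; subst d0; rewrite /= in lN.
have {}l00 : all (fun b : nat * nat => b.1 == 0%N) l := l00.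
pose F i' a s := sv ([:: (0%N, 1%N), (0%N, i') & s], (0%N, a)).
pose G i' a s := sv ((0%N, a) :: s ++ [:: (0%N, i')], (0%N, r)).
set B := (gw5_bound ((0%N, j) :: l) 1 1 0 i).+1.
have wdvv : Rel (\sum_(a < B) conv (F j a) (G i a) l - \sum_(a < B) conv (F i a) (G j a) l).
  exact: Rel_wdvv dD.
have pG (i' a : nat) (t : seq (nat * nat)) :
    perm_eq ((0%N, a) :: t ++ [:: (0%N, i')]) [:: (0%N, i'), (0%N, a) & t].
  by apply/permP => f; rewrite /= !count_cat /=; lia.
have FG_generated (i' j' a : nat) (s t : seq (nat * nat)) :
    (i' + j' = i + j)%N -> perm_eq (s ++ t) l ->
    (deg ([:: (0%N, j'), (0%N, a) & t], (0%N, r)) = D%:Z ->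
     generated (sv ([:: (0%N, j'), (0%N, a) & t], (0%N, r)))) ->
    generated (F i' a s * G j' a t).
  move=> ij st s2G; have szl := split_size st; have swl := split_sumw st.
  apply: generated_mul => /=.
  - move: dD; rewrite !deg_nat (sumw_perm (pG _ _ _)) (size_perm (pG _ _ _)).
    by rewrite !sumw_cons swl /= szl; lia.
  - right; apply: H1; first by rewrite -lN /= szl; lia.
    by move: l00; rewrite -(perm_all _ st) all_cat /= => /andP[].
  right=> dt; apply: (generated_perm (pG _ _ _)); apply: s2G.
  by move: dt; rewrite !deg_nat (sumw_perm (pG _ _ _)) (size_perm (pG _ _ _)).
have UG : generated (\sum_(a < B) conv (F j a) (G i a) l).
  apply: generated_sum => a _; apply: generated_conv => s t st.
  apply: FG_generated => //; first exact: addnC.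
  case: s st => [|b s] st dt; last first.
    by apply: fewer_points; rewrite //= -lN /= (split_size st) /=; lia.
  apply: IHi => //=; first by rewrite -lN (split_size st).
  by rewrite (perm_all _ st).
have WE : \sum_(a < B) conv (F i a) (G j a) l = F i i.+1 [::] * G j i.+1 l +
    (\sum_(a < B | val a != i.+1) F i a [::] * G j a l +
     \sum_(a < B) conv (tail_part (F i a)) (G j a) l).
  have iB : (i.+1 < B)%N by rewrite /B /gw5_bound /=; lia.
  rewrite addrA -(bigD1 (Ordinal iB) (P := xpredT) (F := fun a : 'I_B => F i a [::] * G j a l)) //.
  rewrite -big_split; apply: eq_bigr => a _ /=.
  by rewrite convC conv_tail mulrC convC.
have restG : generated (\sum_(a < B | val a != i.+1) F i a [::] * G j a l +
     \sum_(a < B) conv (tail_part (F i a)) (G j a) l).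
  apply: generatedD.
    (* With nothing split off, the second factor has degree D only for a = i + 1. *)
    apply: generated_sum => a /eqP ai; apply: FG_generated => // dt; case: ai.
    by move: dt dD; rewrite !deg_nat !sumw_cons /=; lia.
  apply: generated_sum => a _; apply: generated_conv => -[|b s] t st.
    by rewrite mul0r; exact: generated0.
  apply: FG_generated => // dt.
  by apply: fewer_points; rewrite //= -lN /= (split_size st) /=; lia.
rewrite WE in wdvv; have TG := generated_addl wdvv restG UG.
have : generated (G j i.+1 l).
  apply: generated_mulV TG; rewrite -(gw2_value_three_point 1 i i.+1).
  by apply/Rel_gen/gen2; rewrite deg_nat /sumw /=; lia.
apply: generated_perm.
by apply/permP => f; rewrite /= count_cat /=; lia.
Qed.
End PrimarySymbols.

(** Induction on the number of entries. Psi classes are removed from the last entry, then from the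
    others, which leaves a primary symbol. *)
Lemma all_generated l k r : deg (l, (k, r)) = D%:Z -> generated (sv (l, (k, r))).
Proof.
have [N] := ubnP (size l); elim: N l k r => // N IHN l k r; rewrite ltnS => lN dD.
have IH s : deg s = D%:Z -> (size s.1 < N)%N -> generated (sv s).
  by case: s => l' [k' r'] ds sN; apply: IHN.
case: l lN dD => [|b [|c l]] lN dD.
- exact: one_point_generated.
- by case: b dD {lN} => a i; exact: two_point_generated.
rewrite /= in lN; case: k dD => [|k] dD; last first.
  apply: generated_trr_last => // [s a sl ds|t a tl dt]; apply: IH => //=.
    by apply: leq_trans lN; rewrite !ltnS.
  by apply: leq_ltn_trans lN; rewrite ltnS.
have [/hasP[x xl x0]|] := boolP (has (fun x : nat * nat => (0 < x.1)%N) [:: b, c & l]).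
  have pl := perm_to_rem xl; apply: (generated_perm pl).
  have szr := size_rem xl; move: dD; rewrite !deg_nat (sumw_perm pl) (size_perm pl) -deg_nat.
  case: (rem x [:: b, c & l]) szr {pl} => [//|y s] [szs] dD.
  case: x x0 dD {xl} => -[//|n] j _ dD; apply: generated_trr_first => // [t a tl dt|t a tl dt];
    apply: IH => //=.
  - by apply: leq_trans lN; rewrite ltnS ltnS -szs.
  - by apply: leq_ltn_trans lN; rewrite ltnS -szs.
rewrite -all_predC => all0.
have {}all0 : all (fun b : nat * nat => b.1 == 0%N) [:: b, c & l].
  by apply: sub_all all0 => x /=; rewrite lt0n negbK.
case: b all0 dD => d i /= /andP[/eqP-> all0] dD.
apply: (primary_generated (N := (size l).+2)) => // s ds sN; apply: IH => //.
exact: leq_trans sN lN.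
Qed.
End Reconstruction.

(** * Induction on the degree, and the isomorphism *)

Lemma sv_generated s : generated (sv s).
Proof.
have [sneg|[D dD]] : deg s < 0 \/ exists D : nat, deg s = D%:Z.
  by case: (deg s) => n; [right; exists n | left].
  by rewrite sv_neg //; exact: generated0.
have [n] := ubnP D; elim: n D s dD => // n IHn D s dD; rewrite ltnS => Dn.
have [D0|D0] := posnP D; first by apply: generated_deg0; rewrite dD D0.
have low t : deg t < D%:Z -> generated (sv t).
  move=> tD; have [tneg|[E dE]] : deg t < 0 \/ exists E : nat, deg t = E%:Z.
    by case: (deg t) => m; [right; exists m | left].
    by rewrite sv_neg //; exact: generated0.
  by apply: (IHn E) => //; apply: leq_trans Dn; move: tD; rewrite dE.
by case: s dD => l [k r] dD; exact: (all_generated D0 low).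
Qed.

Lemma CF_generated q : generated q.
Proof.
rewrite -(malg_cm_evalK q); apply: generated_sum => m _.
apply: generatedM; first exact: generatedC.
rewrite /cm_eval; apply: (big_ind generated).
- by rewrite -mpolyC1E; exact: generatedC.
- exact: generatedM.
move=> f _; elim: (cmonom_val m f) => [|n IHn].
  by rewrite expr0 -mpolyC1E; exact: generatedC.
rewrite exprS; apply: generatedM => //.
have := sv_generated (val f); rewrite /sv; case: insubP => [g _ /val_inj -> //|].
by rewrite (valP f).
Qed.

(* r : A -> GW = C[F]/Rel is an isomorphism:
   injective (kernel is trivial) and surjective. *)
Theorem theorem3p1 :
  (forall p : Aring, Rel (rho p) -> p = 0) /\
  (forall q : CF, exists p : Aring, Rel (q - rho p)).
Proof.
split; last exact: CF_generated.
by move=> p /GW_to_A_Rel; rewrite rhoK.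
Qed.
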